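(* In the 2D network with the LOS-association-only path-loss model, for all $r>0$ and $\tau>0$, $$g_{\mathsf L}(r)\le\overline{g_{\mathsf L}}(r)=\exp\Big(-\beta r-\frac{2\pi\lambda}{\beta^2}\big(1-(1+\beta r)e^{-\beta r}\big)\Big),$$ $$A_{\mathsf L}\le\overline{A}_{\mathsf L}=1-\exp\Big(-\frac{2\pi\lambda}{\beta^2}\Big),$$ $$\kappa_{\mathsf L|\mathsf L}(r,\tau)\le\overline{\kappa_{\mathsf L|\mathsf L}}(r,\tau)=\exp\Big(-\int_r^\infty\frac{2\pi\lambda\,e^{-\beta t}}{1+\tau^{-1}\ell_{\mathsf L}(r)/\ell_{\mathsf L}(t)}\,t\,dt\Big),$$ and $\overline{g_{\mathsf L}}(r)$, $\overline{A}_{\mathsf L}$, $\overline{\kappa_{\mathsf L|\mathsf L}}(r,\tau)$ are the values of $g_{\mathsf L}(r)$, $A_{\mathsf L}$, $\kappa_{\mathsf L|\mathsf L}(r,\tau)$ under independent blocking.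
   Context: 2D network. Base stations have density $\lambda>0$ (homogeneous Poisson point process (PPP) on $\mathbb R^2$), with the typical user at the origin. Blockages form a Boolean model of line segments: centers form a homogeneous PPP of density $\mu>0$, with i.i.d. random lengths $L$ ($0<\mathbb E[L]<\infty$) and independent orientations uniform on $[0,\pi]$; $\beta=2\mu\mathbb E[L]/\pi$. A link of length $r$ from the origin is LoS if no blockage intersects it, with probability $p_{\mathsf L}(r)=e^{-\beta r}$. For two links from the origin of lengths $r_1,r_2$ with directions differing by $\theta\in[0,2\pi]$, $p_{\mathsf L,\mathsf L}(r_1,r_2,\theta)$ is the probability that no blockage intersects either of them. Independent blocking means that $p_{\mathsf L,\mathsf L}(r_1,r_2,\theta)$ is replaced by $e^{-\beta r_1-\beta r_2}$. LOS-association-only path-loss (LAP) model: NLoS power $\ell_{\mathsf N}\equiv0$; LoS power $\ell_{\mathsf L}:[0,\infty)\to(0,\infty)$ bounded and nonincreasing. Under the paper's first-order correlation model (only correlation between the serving link and each interfering link is kept) the quantities of interest are $$g_{\mathsf L}(x)=p_{\mathsf L}(x)\exp\Big(-\lambda\int_0^{2\pi}\int_0^x\frac{p_{\mathsf L,\mathsf L}(x,t,\theta)}{p_{\mathsf L}(x)}t\,dt\,d\theta\Big)$$ (probability that a BS at distance $x$ is LoS and serving), the LoS association probability $A_{\mathsf L}=2\pi\lambda\int_0^\infty g_{\mathsf L}(x)\,x\,dx$, and $$\kappa_{\mathsf L|\mathsf L}(r,\tau)=\exp\Big(-\int_r^\infty\frac{\lambda}{1+\tau^{-1}\ell_{\mathsf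 L}(r)/\ell_{\mathsf L}(t)}\int_0^{2\pi}\frac{p_{\mathsf L,\mathsf L}(r,t,\theta)}{p_{\mathsf L}(r)}d\theta\,t\,dt\Big)$$ (Laplace transform at $\tau/\ell_{\mathsf L}(r)$ of the LoS interference given a LoS serving BS at distance $r$). *)

(* Defs.v *)
From HB Require Import structures.
From mathcomp Require Import all_boot all_order all_algebra.
From mathcomp Require Import finmap.
From mathcomp Require Import all_classical all_reals all_analysis.

Set Implicit Arguments.
Unset Strict Implicit.
Unset Printing Implicit Defensive.

Import Order.TTheory GRing.Theory Num.Theory.
Import numFieldNormedType.Exports.

Local Open Scope classical_set_scope.
Local Open Scope ring_scope.

Section Probability.
Context (d : measure_display) (Omega : measurableType d) (R : realType)
  (P : probability Omega R).

Definition mutually_independent (I : choiceType)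
    (F : I -> set (set Omega)) : Prop :=
  forall (J : {fset I}) (E : I -> set Omega),
    (forall j, j \in J -> F j (E j)) ->
    P (\bigcap_(j in [set` J]) E j) = (\prod_(j <- J) P (E j))%E.

Definition area : set (R * R) -> \bar R :=
  (@lebesgue_measure R \x @lebesgue_measure R)%E.

(* A point process is given by a measurable enumeration of its points; the
   processes considered here have infinitely many points almost surely. *)
Definition point_count (X : nat -> {RV P >-> (R * R)%type}) (B : set (R * R))
    (w : Omega) : \bar R :=
  counting [set n | B (X n w)].

(* The numbers of points in disjoint sets are independent, and Poisson with
   mean mu |B|. The mass function is written out because the library's
   [poisson_pmf] is not the Dirac mass at 0 when the mean is 0. *)
Definition homogeneous_PPP (mu : R) (X : nat -> {RV P >-> (R * R)%type}) : Prop :=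
  forall (m : nat) (B : 'I_m -> set (R * R)) (k : 'I_m -> nat),
    (forall i, measurable (B i)) ->
    (forall i, area (B i) < +oo)%E ->
    trivIset setT B ->
    P (\bigcap_i [set w | point_count X (B i) w = (k i)%:R%:E]) =
    (\prod_i ((mu * fine (area (B i))) ^+ k i / (k i)`!%:R
              * expR (- (mu * fine (area (B i))))))%:E.

Definition sigma_RV d' (T : measurableType d') (Y : {RV P >-> T}) :
    set (set Omega) :=
  [set E | exists2 A, measurable A & E = Y @^-1` A].

Definition sigma_RVs d' (T : measurableType d') (Y : nat -> {RV P >-> T}) :
    set (set Omega) :=
  <<s \bigcup_n sigma_RV (Y n) >>.

Definition identically_distributed d' (T : measurableType d')
    (Y : nat -> {RV P >-> T}) : Prop :=
  forall n A, measurable A -> distribution P (Y n) A = distribution P (Y 0%N) A.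

(* Independent marking: the point process as a whole, each length and each
   orientation form one mutually independent family. *)
Definition sigma_germs_marks (X : nat -> {RV P >-> (R * R)%type})
    (L Phi : nat -> {RV P >-> R}) (i : option (nat + nat)) : set (set Omega) :=
  match i with
  | None => sigma_RVs X
  | Some (inl n) => sigma_RV (L n)
  | Some (inr n) => sigma_RV (Phi n)
  end.

Record segment_boolean_model (mu : R) (X : nat -> {RV P >-> (R * R)%type})
    (L Phi : nat -> {RV P >-> R}) : Prop := {
  centers_PPP : homogeneous_PPP mu X ;
  lengths_ge0 : forall n w, 0 <= L n w ;
  lengths_identically_distributed : identically_distributed L ;
  lengths_mean_gt0 : (0 < 'E_P[L 0%N])%E ;
  lengths_mean_lty : ('E_P[L 0%N] < +oo)%E ;
  orientations_uniform : forall n A, measurable A ->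
    distribution P (Phi n) A = uniform_prob (@pi_gt0 R) A ;
  germs_marks_independent : mutually_independent (sigma_germs_marks X L Phi)
}.

Definition blockage (c : R * R) (l phi : R) : set (R * R) :=
  [set p | exists2 s, `|s| <= l / 2 &
     p = (c.1 + s * cos phi, c.2 + s * sin phi)].

Definition link (r alpha : R) : set (R * R) :=
  [set p | exists2 u, 0 <= u <= r & p = (u * cos alpha, u * sin alpha)].

Definition unblocked (X : nat -> {RV P >-> (R * R)%type})
    (L Phi : nat -> {RV P >-> R}) (K : set (R * R)) : set Omega :=
  [set w | forall n, blockage (X n w) (L n w) (Phi n w) `&` K = set0].

(* [alpha] is the direction of the link of length [r] (resp. [r1]); by
   isotropy of the blockages the probabilities do not depend on it. *)
Definition pL X L Phi (alpha r : R) : R :=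
  fine (P (unblocked X L Phi (link r alpha))).

Definition pLL X L Phi (alpha r1 r2 theta : R) : R :=
  fine (P (unblocked X L Phi (link r1 alpha) `&`
           unblocked X L Phi (link r2 (alpha + theta)))).

Definition blockage_rate (mu : R) (L : nat -> {RV P >-> R}) : R :=
  2 * mu * fine 'E_P[L 0%N] / pi.

End Probability.

(* The quantities of interest as functionals of the LoS probability [p] and the
   joint LoS probability [q], so that they can be evaluated both for the true
   joint probability and under independent blocking. They are extended reals
   because the integrals of nonnegative functions below are a priori infinite;
   [expeR -oo = 0]. *)
Section Functionals.
Context (R : realType).
Local Notation leb := (@lebesgue_measure R).
Local Open Scope ereal_scope.

Definition gL (lambda : R) (p : R -> R) (q : R -> R -> R -> R) (x : R) : \bar R :=
  (p x)%:E *
  expeR (- (lambda%:E *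
    \int[leb]_(theta in `[0%R, (2 * pi)%R])
      \int[leb]_(t in `[0%R, x]) (q x t theta / p x * t)%:E)).

Definition AL (lambda : R) (p : R -> R) (q : R -> R -> R -> R) : \bar R :=
  (2 * pi * lambda)%:E *
  \int[leb]_(x in `[0%R, +oo[) (gL lambda p q x * x%:E).

Definition kappaLL (lambda : R) (ell p : R -> R) (q : R -> R -> R -> R)
    (r tau : R) : \bar R :=
  expeR (- \int[leb]_(t in `[r, +oo[)
    ((lambda / (1 + tau^-1 * (ell r / ell t)))%:E *
     (\int[leb]_(theta in `[0%R, (2 * pi)%R]) (q r t theta / p r)%:E) *
     t%:E)).

Definition independent_blocking (beta r1 r2 theta : R) : R :=
  expR (- beta * r1 - beta * r2).

Definition gL_bar (lambda beta r : R) : R :=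
  expR (- beta * r -
        2 * pi * lambda / beta ^+ 2 * (1 - (1 + beta * r) * expR (- beta * r))).

Definition AL_bar (lambda beta : R) : R :=
  1 - expR (- (2 * pi * lambda / beta ^+ 2)).

Definition kappaLL_bar (lambda beta : R) (ell : R -> R) (r tau : R) : \bar R :=
  expeR (- \int[leb]_(t in `[r, +oo[)
    (2 * pi * lambda * expR (- beta * t)
     / (1 + tau^-1 * (ell r / ell t)) * t)%:E).

End Functionals.

(* Main.v *)
Require Import Defs.
From HB Require Import structures.
From mathcomp Require Import all_boot all_order all_algebra finmap.
From mathcomp Require Import all_classical all_reals all_analysis measurable_realfun.
From mathcomp Require Import ring lra.
Set Implicit Arguments.
Unset Strict Implicit.
Unset Printing Implicit Defensive.
Import Order.TTheory GRing.Theory Num.Theory.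
Import numFieldNormedType.Exports.
Local Open Scope classical_set_scope.
Local Open Scope ring_scope.

(** The centers are a Poisson process and the marks are independent of it, so
    the probability that no blockage falls in a set [S] of (center, mark) pairs
    is [exp (- mu * (area x mark law) S)]: integrating the marks out turns it
    into the probability generating functional of the centers at
    [1 - h] with [h x] the mark law of the section of [S] at [x]. For a fixed
    mark the centers hitting a link of length [r] form a parallelogram of area
    [r l |sin (phi - alpha)|], whence [pL r = exp (- beta r)]; and the centers
    hitting one of two links have measure at most the sum of the two measures,
    whence [pLL r1 r2 theta >= exp (- beta r1 - beta r2)]. The three bounds
    follow by monotonicity, and the values under independent blocking are
    elementary integrals. *)

(** [homogeneous_PPP] prescribes only the joint law of the counts in disjoint sets of finite area,
    not the law of a single point [X n] of the enumeration. Expectations of products over the points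
    are therefore reached through counts: they are explicit for functions with finitely many values,
    and a general [h] is rounded to such functions. Two limits occur, the rounding and the
    truncation to the first [N] points, which the finite character of independence imposes. They can
    be combined because, at a simple function, every truncated expectation is already at least its
    limit. The joint probability is never computed: the mass of a union is at most the sum of the
    masses, whatever the angle [theta], and this bound is all that the functionals use of it. The
    rate comes out as [mu * r * E[L] * (2 / pi) = beta * r], where [2 / pi] is the mean of [|sin|]
    for a uniform orientation. *)

Section MeasureTools.
Local Open Scope ereal_scope.

(** The complement of [D] is null for the restricted measure, and on subsets of [D] the two measures
    agree. This turns an integral over an event into one that can be pushed forward. *)
Lemma ge0_integral_mrestr d (T : measurableType d) (R : realType)
    (mu : {measure set T -> \bar R}) (D : set T) (mD : measurable D)
    (f : T -> \bar R) : measurable_fun setT f -> (forall x, 0 <= f x) ->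
  \int[mrestr mu mD]_x f x = \int[mu]_(x in D) f x.
Proof.
move=> mf f0.
rewrite -(setUv D) ge0_integral_setU//=; [|exact: measurableC| |]; last 2 first.
- by rewrite setUv.
- exact/disj_setPCl.
rewrite [X in _ + X](_ : _ = 0) ?adde0.
  by apply: eq_measure_integral => A mA AD; rewrite /= /mrestr setIidl.
apply: null_set_integral => //; first exact: measurableC.
- exact: measurable_funTS.
- by rewrite /= /mrestr setICl measure0.
Qed.

(** Carries finiteness over to the image measure, so that it can enter Tonelli's theorem and the
    uniqueness of product measures, both of which need sigma-finite factors. *)
Lemma finite_pushforward d d' (T : measurableType d) (T' : measurableType d')
    (R : realType) (m : {finite_measure set T -> \bar R}) (f : T -> T') :
  measurable_fun setT f ->
  {m' : {finite_measure set T' -> \bar R} |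
    forall A, m' A = m (f @^-1` A)}.
Proof.
move=> mf.
have mfA A : measurable A -> measurable (f @^-1` A).
  by move=> mA; rewrite -[X in measurable X]setTI; exact: mf.
pose m1 : {measure set T' -> \bar R} :=
  measure_function_pushforward__canonical__measure_function_Measure m mf.
have fin : fin_num_fun m1.
  by move=> A mA; rewrite /m1/= /pushforward fin_num_measure//; exact: mfA.
pose B := @Measure_isFinite.Build _ _ _ m1 fin.
pose m2 := HB.pack_for {finite_measure set T' -> \bar R} (pushforward m f) (Measure.class m1) B.
by exists (m2 mf).
Qed.

End MeasureTools.

(** * Integrating out independent marks *)

Section PairIndependence.
Context d d2 d3 (Omega : measurableType d) (T2 : measurableType d2)
  (T3 : measurableType d3) (R : realType).
Variables (P : probability Omega R) (n2 : probability T2 R)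
  (n3 : probability T3 R) (Y : Omega -> T2) (Z : Omega -> T3).
Hypotheses (mY : measurable_fun setT Y) (mZ : measurable_fun setT Z).
Local Open Scope ereal_scope.

Let YZ (w : Omega) := (Y w, Z w).
Let mYZ : measurable_fun setT YZ.
Proof. exact: measurable_fun_pair. Qed.

(** On rectangles the law of [(Y, Z)] restricted to [H] is the product of [P H * n2] and [n3], and a
    product measure is determined by its rectangles. The event [H] will carry the germs and the
    other marks. *)
Lemma pair_independent (H : set Omega) : measurable H ->
  (forall C D, measurable C -> measurable D ->
    P (H `&` (Y @^-1` C `&` Z @^-1` D)) = P H * (n2 C * n3 D)) ->
  forall V, measurable V ->
    P (H `&` YZ @^-1` V) = P H * (n2 \x n3) V.
Proof.
move=> mH ind V mV.
have PH0 : (0 <= fine (P H))%R by apply: fine_ge0.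
pose k : {nonneg R} := NngNum PH0.
have [m1 m1E] := finite_pushforward (mrestr P mH) mY.
have m1s C : measurable C -> m1 C = mscale k n2 C.
  move=> mC; rewrite m1E /= /mscale /mrestr/= fineK ?fin_num_measure//.
  have := ind C setT mC measurableT.
  by rewrite preimage_setT setIT probability_setT mule1 setIC.
pose m' : {measure set (T2 * T3) -> \bar R} :=
  measure_function_pushforward__canonical__measure_function_Measure
    (mrestr P mH) mYZ.
transitivity (m' V); first by rewrite /m' /= /pushforward /mrestr setIC.
rewrite -(@product_measure_unique _ _ _ _ _ m1 n3)//; last first.
  move=> A B mA mB; transitivity (mscale k n2 A * n3 B); last first.
    by congr (_ * _); exact/esym/m1s.
  rewrite /m' /= /pushforward /mscale /mrestr/=.
  by rewrite fineK ?fin_num_measure// -muleA -ind// setIC.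
rewrite /product_measure1/=.
rewrite (@eq_measure_integral _ _ _ _ (mscale k n2)); last first.
  by move=> A mA _; exact: m1s.
rewrite ge0_integral_mscale//; first by rewrite /= fineK ?fin_num_measure.
exact: measurable_fun_xsection.
Qed.

End PairIndependence.

Section Freezing.
Context d d1 d2 (Omega : measurableType d) (T1 : measurableType d1)
  (T2 : measurableType d2) (R : realType).
Variables (P : probability Omega R) (n2 : probability T2 R).
Variables (p : Omega -> T1) (Y : Omega -> T2).
Hypotheses (mp : measurable_fun setT p) (mY : measurable_fun setT Y).
Local Open Scope ereal_scope.

(** On the event [H], the pair [(p, Y)] has as law the product of the restricted law of [p] and
    [n2]; Tonelli then integrates [Y] out at fixed [p]. *)
Lemma freezing (H : set Omega) : measurable H ->
  (forall U V, measurable U -> measurable V ->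
    P (H `&` (p @^-1` U `&` Y @^-1` V)) = P (H `&` p @^-1` U) * n2 V) ->
  forall F : T1 * T2 -> \bar R, measurable_fun setT F -> (forall x, 0 <= F x) ->
  \int[P]_(w in H) F (p w, Y w) = \int[P]_(w in H) \int[n2]_y F (p w, y).
Proof.
move=> mH ind F mF F0.
have mpY : measurable_fun setT (fun w => (p w, Y w)) by exact: measurable_fun_pair.
have mG : measurable_fun setT (fun x => \int[n2]_y F (x, y)).
  exact: measurable_fun_fubini_tonelli_F.
have [m1 m1E] := finite_pushforward (mrestr P mH) mp.
rewrite -ge0_integral_mrestr//; last exact: measurableT_comp mF mpY.
rewrite -[RHS]ge0_integral_mrestr//; last 2 first.
  exact: measurableT_comp mG mp.
  by move=> w; exact: integral_ge0.
rewrite -[LHS](@ge0_integral_pushforward _ _ _ _ _ _ mpY _ setT)//.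
rewrite -[RHS](@ge0_integral_pushforward _ _ _ _ _ _ mp _ setT
  (fun x => \int[n2]_y F (x, y)))//; last first.
  by move=> w _; exact: integral_ge0.
rewrite [RHS](@eq_measure_integral _ _ _ _ m1); last first.
  by move=> A mA _; exact/esym/m1E.
rewrite -(@fubini_tonelli1 _ _ _ _ _ m1 n2)//.
apply: eq_measure_integral => A mA _; apply/esym.
apply: (@product_measure_unique _ _ _ _ _ m1 n2
  (measure_function_pushforward__canonical__measure_function_Measure
    (mrestr P mH) mpY)) => // U V mU mV.
transitivity (mrestr P mH (p @^-1` U) * n2 V); last by congr (_ * _); exact/esym/m1E.
by rewrite /= /pushforward /mrestr/= [in RHS]setIC -ind// setIC.
Qed.

End Freezing.

Section Marking.
Context d d1 d2 d3 (Omega : measurableType d) (T1 : measurableType d1)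
  (T2 : measurableType d2) (T3 : measurableType d3) (R : realType).
Variables (P : probability Omega R) (n2 : probability T2 R)
  (n3 : probability T3 R).
Variables (p : Omega -> T1) (Y : nat -> Omega -> T2) (Z : nat -> Omega -> T3).
Hypotheses (mp : measurable_fun setT p) (mY : forall n, measurable_fun setT (Y n))
  (mZ : forall n, measurable_fun setT (Z n)).
Local Open Scope ereal_scope.

Hypothesis ind : forall N U C D, measurable U -> (forall n, measurable (C n)) ->
  (forall n, measurable (D n)) ->
  P (p @^-1` U `&` \bigcap_(n < N) (Y n @^-1` C n `&` Z n @^-1` D n)) =
  P (p @^-1` U) * (\prod_(n < N) (fine (n2 (C n)) * fine (n3 (D n))))%:E.

Let nu : probability (T2 * T3)%type R := n2 \x n3.

(** The conditional probability of [hit S n] given that [p] takes the value [x]. *)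
Let sec (S : set (T1 * (T2 * T3))) (x : T1) : R :=
  fine (nu (xsection S x)).

Let hit (S : set (T1 * (T2 * T3))) (n : nat) : set Omega :=
  [set w | S (p w, (Y n w, Z n w))].

Let measurable_hit S n : measurable S -> measurable (hit S n).
Proof.
move=> mS; rewrite -[X in measurable X]setTI.
by apply: (measurable_fun_pair mp (measurable_fun_pair (mY n) (mZ n))).
Qed.

Let sec_ge0 S x : (0 <= sec S x)%R. Proof. exact: fine_ge0. Qed.

Let measurable_sec S : measurable S -> measurable_fun setT (sec S).
Proof.
move=> mS; have h := measurable_fun_xsection nu mS.
exact: (measurableT_comp (fine_measurable measurableT) h).
Qed.

Let sec_box C D x : measurable C -> measurable D ->
  sec (setT `*` (C `*` D)) x = (fine (n2 C) * fine (n3 D))%R.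
Proof.
move=> mC mD; rewrite /sec in_xsectionX ?inE//.
by rewrite /= product_measure1E// fineM// fin_num_measure.
Qed.

Let box (S : set (T1 * (T2 * T3))) := exists CD : set T2 * set T3,
  [/\ measurable CD.1, measurable CD.2 & S = setT `*` (CD.1 `*` CD.2)].

Let measurable_cap S N : (forall n, measurable (S n)) ->
  measurable (\bigcap_(n < N) hit (S n) n).
Proof. by move=> mS; apply: fin_bigcap_measurable => // n _; exact: measurable_hit. Qed.

(** For boxes the event concerns the marks alone and the section masses are constant. Both sides are
    then integrals of [f] against measures on [T1] which [ind] identifies. *)
Let marking_boxes N S f : (forall n, measurable (S n)) ->
  (forall n, (n < N)%N -> box (S n)) ->
  measurable_fun setT f -> (forall x, 0 <= f x) ->
  \int[P]_(w in \bigcap_(n < N) hit (S n) n) f (p w) =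
  \int[P]_w (f (p w) * (\prod_(n < N) sec (S n) (p w))%:E).
Proof.
move=> mS bS mf f0.
have /choice[CD CDE] : forall n, exists CD : set T2 * set T3,
    [/\ measurable CD.1, measurable CD.2 &
        (n < N)%N -> S n = setT `*` (CD.1 `*` CD.2)].
  move=> n; have [nN|nN] := boolP (n < N)%N.
    by have [CD [? ? ?]] := bS n nN; exists CD.
  by exists (setT, setT); split => //=; rewrite (negbTE nN).
have mC n : measurable (CD n).1 by case: (CDE n).
have mD n : measurable (CD n).2 by case: (CDE n).
pose c : R := (\prod_(n < N) (fine (n2 (CD n).1) * fine (n3 (CD n).2)))%R.
have c0 : (0 <= c)%R by apply: prodr_ge0 => n _; rewrite mulr_ge0// fine_ge0.
transitivity (\int[P]_w (f (p w) * c%:E)); last first.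
  apply: eq_integral => w _; congr (_ * _%:E); apply: eq_bigr => n _.
  by have [? ? ->//] := CDE n; rewrite sec_box.
have mH := measurable_cap N mS.
rewrite -(ge0_integral_mrestr P mH); last 2 first.
  exact: (measurableT_comp mf mp).
  by move=> w.
rewrite -[LHS](@ge0_integral_pushforward _ _ _ _ _ _ mp _ setT f)//.
rewrite ge0_integralZr//; last exact: (measurableT_comp mf mp).
rewrite -[X in _ = X * _](@ge0_integral_pushforward _ _ _ _ _ _ mp _ setT f)//.
rewrite [RHS]muleC -(@ge0_integral_mscale _ _ _ _ _ measurableT (NngNum c0))//.
apply: eq_measure_integral => U mU _.
rewrite /= /pushforward /mrestr /mscale /= [RHS]muleC.
apply: etrans (ind N mU mC mD).
congr (P (_ `&` _)); apply: eq_bigcapr => n /= nN.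
have [_ _ E] := CDE n; rewrite /hit E//.
by apply/seteqP; split => w /= [] => [_ []|].
Qed.

(* The first [j] sets are arbitrary and the others are boxes in the mark
   variables; passing from [j] to [j + 1] freezes everything but mark [j],
   whose independence of the rest is the case [j] itself. *)
Lemma marking N S f : (forall n, measurable (S n)) ->
  measurable_fun setT f -> (forall x, 0 <= f x) ->
  \int[P]_(w in \bigcap_(n < N) hit (S n) n) f (p w) =
  \int[P]_w (f (p w) * (\prod_(n < N) sec (S n) (p w))%:E).
Proof.
suff claim j : (j <= N)%N -> forall S f, (forall n, measurable (S n)) ->
    (forall n, (j <= n)%N -> (n < N)%N -> box (S n)) ->
    measurable_fun setT f -> (forall x, 0 <= f x) ->
    \int[P]_(w in \bigcap_(n < N) hit (S n) n) f (p w) =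
    \int[P]_w (f (p w) * (\prod_(n < N) sec (S n) (p w))%:E).
  move=> mS; apply: (claim N) => // n Nn; by rewrite ltnNge Nn.
elim: j => [_ {}S {}f mS bS|j IH jN {}S {}f mS bS mf f0].
  by apply: marking_boxes => // n; exact: bS.
(* [S' B] puts [B] in position [j]. The induction hypothesis applies as soon as [B] is a box, in
   particular for [setT], which leaves mark [j] free. *)
pose S' B n := if n == j then B else S n.
have S'j B : S' B j = B by rewrite /S' eqxx.
have S'n B n : n != j -> S' B n = S n by rewrite /S' => /negbTE ->.
have mS' B n : measurable B -> measurable (S' B n).
  by rewrite /S'; case: ifP.
have bS' B : box B -> forall n, (j <= n)%N -> (n < N)%N -> box (S' B n).
  move=> bB n jn nN; rewrite /S'; case: ifPn => // nj.
  by apply: bS => //; rewrite ltn_neqAle eq_sym nj.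
have boxC C D : measurable C -> measurable D -> box (setT `*` (C `*` D)).
  by move=> mC mD; exists (C, D).
have boxT : box setT by exists (setT, setT); split => //=; rewrite !setXTT.
have capS' B : \bigcap_(n < N) hit (S' B n) n =
    \bigcap_(n < N) hit (S' setT n) n `&` hit B j.
  apply/seteqP; split => [w h|w [h hj] n nN].
    split; last by have := h j jN; rewrite S'j.
    move=> n nN; have [->|nj] := eqVneq n j; first by rewrite S'j.
    by have := h n nN; rewrite !S'n.
  have [->|nj] := eqVneq n j; first by rewrite S'j.
  by have := h n nN; rewrite !S'n.
pose rest x := (\prod_(n < N | n != Ordinal jN) sec (S n) x)%R.
have rest0 x : (0 <= rest x)%R by exact: prodr_ge0.
have mrest : measurable_fun setT rest.
  rewrite /rest; under eq_fun do rewrite big_mkcond/=.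
  apply: measurable_prod => n _; case: (n != Ordinal jN) => //; exact: measurable_sec.
have prodS' B x : (\prod_(n < N) sec (S' B n) x = sec B x * rest x)%R.
  rewrite (bigD1 (Ordinal jN))//= S'j; congr (_ * _)%R.
  by apply: eq_bigr => n nj; rewrite S'n.
have IH' B g : measurable B -> box B -> measurable_fun setT g ->
    (forall x, 0 <= g x) ->
    \int[P]_(w in \bigcap_(n < N) hit (S' B n) n) g (p w) =
    \int[P]_w (g (p w) * (sec B (p w) * rest (p w))%:E).
  move=> mB bB mg g0; rewrite (IH (ltnW jN) (S' B) g)//; last 2 first.
    by move=> n; exact: mS'.
    exact: bS'.
  by apply: eq_integral => w _; rewrite prodS'.
set H := \bigcap_(n < N) hit (S' setT n) n in capS'.
have mH : measurable H by apply: measurable_cap => n; exact: mS'.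
have secT x : sec setT x = 1%R.
  have := sec_box x (@measurableT _ T2) (@measurableT _ T3).
  by rewrite !setXTT !probability_setT mul1r.
have mfn : measurable_fun setT (fun z : T1 * (T2 * T3) => f z.1 * (\1_(S j) z)%:E).
  apply: emeasurable_funM; first exact: (measurableT_comp mf measurable_fst).
  exact/measurable_EFinP/measurable_indic.
(* The induction hypothesis with the indicator of [U] as weight; comparing a box with [setT] in
   position [j] gives the independence of mark [j] that [freezing] requires. *)
have PHU B U : measurable B -> box B -> measurable U ->
    P ((p @^-1` U) `&` (\bigcap_(n < N) hit (S' B n) n)) =
    \int[P]_w ((\1_U (p w))%:E * (sec B (p w) * rest (p w))%:E).
  move=> mB bB mU; rewrite -(IH' B (fun x => (\1_U x)%:E))//; last first.
    exact/measurable_EFinP/measurable_indic.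
  under [RHS]eq_integral => w _ do
    rewrite (_ : (\1_U (p w))%:E = (\1_(p @^-1` U) w)%:E)//.
  rewrite integral_indic//.
    by apply: measurable_cap => n; exact: mS'.
  by rewrite -[X in measurable X]setTI; exact: mp.
have freeze : \int[P]_(w in H) (f (p w) * (\1_(S j) (p w, (Y j w, Z j w)))%:E) =
    \int[P]_(w in H) \int[nu]_y (f (p w) * (\1_(S j) (p w, y))%:E).
  apply: (@freezing _ _ _ _ _ _ _ P nu p (fun w => (Y j w, Z j w))
    mp _ H mH _ (fun z => f z.1 * (\1_(S j) z)%:E)) => //.
  - exact: measurable_fun_pair.
  - move=> U V mU mV; rewrite setIA.
  have mHU : measurable (H `&` p @^-1` U).
    by apply: measurableI => //; rewrite -[X in measurable X]setTI; exact: mp.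
  apply: pair_independent => // C D mC mD.
  rewrite -setIA [p @^-1` U `&` _]setIC setIA.
  have mCD : measurable ([set: T1] `*` (C `*` D)) by do 2 apply: measurableX => //.
  rewrite (_ : H `&` _ = \bigcap_(n < N) hit (S' (setT `*` (C `*` D)) n) n); last first.
    rewrite capS'; congr (_ `&` _); apply/seteqP.
    by split => w /= => [[]|[_ []]].
  rewrite setIC PHU//; last exact: boxC.
  rewrite [in RHS]setIC /H PHU//.
  under eq_integral do rewrite sec_box//.
  under [in RHS]eq_integral do rewrite secT mul1r.
  under eq_integral do rewrite EFinM muleCA.
  rewrite ge0_integralZl ?EFinM ?fineK ?fin_num_measure//; last first.
  - by rewrite mule_ge0.
  - by move=> w _; rewrite mule_ge0// lee_fin.
  - apply: emeasurable_funM; apply/measurable_EFinP.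
      exact: (measurableT_comp (measurable_indic mU) mp).
    exact: (measurableT_comp mrest mp).
  by rewrite muleC.
  - by move=> z; rewrite mule_ge0// lee_fin.
(* Once mark [j] is integrated out, its section mass depends on the germ only; it is absorbed into
   the weight, and the induction hypothesis is used again with [setT] in position [j]. *)
pose g x := f x * (sec (S j) x)%:E.
have mg : measurable_fun setT g.
  by apply: emeasurable_funM => //; apply/measurable_EFinP; exact: measurable_sec.
have g0 x : 0 <= g x by rewrite mule_ge0// lee_fin.
transitivity (\int[P]_(w in H) g (p w)).
  rewrite -[in LHS](_ : S' (S j) = S); last first.
    by apply/funext => n; rewrite /S'; case: eqP => // ->.
  rewrite capS' integral_mkcondr.
  transitivity (\int[P]_(w in H) (f (p w) * (\1_(S j) (p w, (Y j w, Z j w)))%:E)).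
    apply: eq_integral => w _; rewrite patchE indicE.
    rewrite (_ : (w \in hit (S j) j) = ((p w, (Y j w, Z j w)) \in S j)).
      by case: ifP => _; rewrite ?mule1 ?mule0.
    by apply/idP/idP => /[!inE].
  rewrite freeze; apply: eq_integral => w _.
  have mx : measurable (xsection (S j) (p w)) by exact: measurable_xsection.
  have xE : (fun y => (\1_(S j) (p w, y))%:E) =
      (fun y => (\1_(xsection (S j) (p w)) y : R)%:E).
    by apply/funext => y; rewrite !indicE mem_xsection.
  rewrite ge0_integralZl//; last first.
    by rewrite xE; exact/measurable_EFinP/measurable_indic.
  by rewrite xE integral_indic// setIT /g /sec fineK// fin_num_measure.
rewrite IH'//; apply: eq_integral => w _.
rewrite secT mul1r /g -muleA -EFinM; congr (_ * _%:E).
by rewrite [RHS](bigD1 (Ordinal jN)).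
Qed.

End Marking.

(** * Expectation of a product of independent discrete factors *)

Section DiscreteProductLaw.
Context d (Omega : measurableType d) (R : realType) (P : probability Omega R).
Local Open Scope ereal_scope.
Variables (m : nat) (A : 'I_m -> nat -> set Omega) (q u : 'I_m -> nat -> R)
  (T : 'I_m -> Omega -> R) (Q : 'I_m -> R).
Hypotheses (mA : forall i k, measurable (A i k))
  (u0 : forall i k, (0 <= u i k)%R) (q0 : forall i k, (0 <= q i k)%R)
  (PA : forall k : 'I_m -> nat,
    P (\bigcap_i A i (k i)) = (\prod_i q i (k i))%:E)
  (TE : forall i w, \sum_(k <oo) (u i k * \1_(A i k) w)%:E = (T i w)%:E)
  (QE : forall i, \sum_(k <oo) (u i k * q i k)%:E = (Q i)%:E).

Let T0 i w : (0 <= T i w)%R.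
Proof.
by rewrite -lee_fin -TE; apply: nneseries_ge0 => k _ _; rewrite lee_fin mulr_ge0.
Qed.

Let mT i : measurable_fun setT (T i).
Proof.
apply/measurable_EFinP; rewrite (_ : _ \o _ =
    fun w => \sum_(k <oo) (u i k * \1_(A i k) w)%:E); last by apply/funext => w /=.
apply: ge0_emeasurable_sum => [k w _ _|k _]; first by rewrite lee_fin mulr_ge0.
apply/measurable_EFinP; apply: measurable_funM; first exact: measurable_cst.
exact: measurable_indic.
Qed.

(** [PA] factorises only events that fix all the indices at once, so the series for the [T i] are
    expanded one factor at a time, with monotone convergence exchanging sum and integral. *)
Lemma integral_prod_discrete : \int[P]_w (\prod_i T i w)%:E = (\prod_i Q i)%:E.
Proof.
have mI (s : seq 'I_m) (k : 'I_m -> nat) :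
    measurable (\bigcap_(i in [set i | i \notin s]) A i (k i)).
  by apply: fin_bigcap_measurable => //; exact: finite_finset.
have mprod (s : seq 'I_m) B : measurable B ->
    measurable_fun setT (fun w => (\prod_(i <- s) T i w * \1_B w)%:E).
  move=> mB; apply/measurable_EFinP; apply: measurable_funM.
    exact: measurable_prod.
  exact: measurable_indic.
(* Factors in [s] are expanded, the other indices stay fixed at [k]. For a new factor [i], each term
   of its series fixes the index of [i] to some [n], which is the induction hypothesis at [k' n]. *)
have claim s : uniq s -> forall k : 'I_m -> nat,
    \int[P]_w (\prod_(i <- s) T i w *
      \1_(\bigcap_(i in [set i | i \notin s]) A i (k i)) w)%:E =
    (\prod_(i <- s) Q i * \prod_(i | i \notin s) q i (k i))%:E.
  elim: s => [_ k|i s IH /= /andP[is_ us] k].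
    under eq_integral do rewrite big_nil mul1r.
    rewrite integral_indic// setIT big_nil mul1r -PA.
    by congr (P _); apply: eq_bigcapl; split.
  pose k' n j := if j == i then n else k j.
  have capE n : \bigcap_(j in [set j | j \notin s]) A j (k' n j) =
      A i n `&` \bigcap_(j in [set j | j \notin i :: s]) A j (k j).
    apply/seteqP; split => w.
      move=> h; split; first by have := h i is_; rewrite /k' eqxx.
      move=> j /=; rewrite inE negb_or => /andP[ji js].
      by have := h j js; rewrite /k' (negbTE ji).
    move=> [hi h] j /= js; rewrite /k'; case: eqP => [->//|/eqP ji].
    by apply: h; rewrite /= inE negb_or ji.
  have T0' w : (0 <= \prod_(j <- s) T j w)%R by apply: prodr_ge0.
  transitivity (\int[P]_w \sum_(n <oo) ((u i n)%:E * (\prod_(j <- s) T j w *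
      \1_(\bigcap_(j in [set j | j \notin s]) A j (k' n j)) w)%:E)).
    apply: eq_integral => w _.
    rewrite big_cons mulrAC -mulrA EFinM -TE muleC -nneseriesZl; last first.
      by move=> n _; rewrite lee_fin mulr_ge0.
    apply: eq_eseriesr => n _; rewrite -!EFinM capE indicI; congr _%:E.
    by rewrite /=; ring.
  rewrite integral_nneseries//; last 2 first.
    by move=> n; apply: emeasurable_funM => //; exact: mprod.
    by move=> n w _; rewrite mule_ge0// lee_fin// mulr_ge0.
  transitivity (\sum_(n <oo) ((\prod_(j <- s) Q j *
      \prod_(j | j \notin i :: s) q j (k j))%:E * (u i n * q i n)%:E)).
    apply: eq_eseriesr => n _; rewrite ge0_integralZl_EFin//; last 2 first.
      by move=> w _; rewrite lee_fin mulr_ge0.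
      exact: mprod.
    rewrite IH// -!EFinM; congr _%:E.
    rewrite (bigD1 i)//= {1}/k' eqxx.
    have -> : (\prod_(j | (j \notin s) && (j != i)) q j (k' n j) =
        \prod_(j | j \notin i :: s) q j (k j))%R.
      apply: eq_big => [j|j /andP[_ ji]]; first by rewrite inE negb_or andbC.
      by rewrite /k' (negbTE ji).
    by ring.
  rewrite nneseriesZl; last by move=> n _; rewrite lee_fin mulr_ge0.
  by rewrite QE -EFinM big_cons; congr _%:E; ring.
(* With all factors expanded, the remaining intersection has no index, so the choice of [k] is
   immaterial. *)
have := claim (index_enum 'I_m) (index_enum_uniq _) (fun=> 0%N).
rewrite [X in (_ * X)%R](_ : _ = 1%R); last first.
  by rewrite big_pred0// => i; rewrite mem_index_enum.
rewrite mulr1 => <-; apply: eq_integral => w _.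
rewrite indicE mem_set ?mulr1// => i /=.
by rewrite mem_index_enum.
Qed.

End DiscreteProductLaw.

(** * Counts of points and their truncations *)

Section PointCount.
Context d (Omega : measurableType d) (R : realType) (P : probability Omega R)
  (X : nat -> {RV P >-> (R * R)%type}).
Local Open Scope ereal_scope.

(** Sigma-additivity of the counting measure over singletons. The series form makes counts
    measurable and comparable with their partial sums. *)
Lemma point_countE (B : set (R * R)) w :
  point_count X B w = \sum_(n <oo) (\1_B (X n w))%:E.
Proof.
rewrite /point_count; set S := [set n | B (X n w)].
have SE : S = \bigcup_n (S `&` [set n]).
  by apply/seteqP; split => [n Sn|n [k _ []//]]; exists n.
rewrite [in LHS]SE (@measure_bigcup _ _ _ (@counting nat R)); last 2 first.
  by [].
  by move=> i j _ _ [k [[_ ki] [_ kj]]]; rewrite -[i]ki -[j]kj.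
transitivity (\sum_(n <oo) counting (S `&` [set n]) : \bar R).
  by apply: eq_eseriesl => n; rewrite in_setT.
apply: eq_eseriesr => n _; rewrite indicE.
have [BX|BX] := boolP (X n w \in B).
  rewrite setIidr; last by move=> _ ->; rewrite inE in BX.
  by rewrite /counting asboolT// fset_set1 cardfs1.
rewrite (_ : S `&` [set n] = set0) ?measure0//.
by apply/seteqP; split => // k [Sk kn]; move: BX; rewrite notin_setE; apply; rewrite -kn.
Qed.

Lemma measurable_point_count (B : set (R * R)) k : measurable B ->
  measurable [set w | point_count X B w = k%:R%:E].
Proof.
move=> mB.
have mf : measurable_fun setT (fun w => \sum_(n <oo) (\1_B (X n w) : R)%:E).
  apply: ge0_emeasurable_sum => [n w _ _|n _]; first by rewrite lee_fin.
  by apply/measurable_EFinP; exact: (measurableT_comp (measurable_indic mB)).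
have -> : [set w | point_count X B w = k%:R%:E] =
    setT `&` (fun w => \sum_(n <oo) (\1_B (X n w) : R)%:E) @^-1` [set k%:R%:E].
  by rewrite setTI; apply/seteqP; split => w /=; rewrite point_countE.
exact: mf.
Qed.

Definition first_points (B : set (R * R)) (N : nat) (w : Omega) : nat :=
  \sum_(n < N) (X n w \in B).

Lemma first_points_le (B : set (R * R)) N w k :
  point_count X B w = k%:R%:E -> (first_points B N w <= k)%N.
Proof.
rewrite point_countE -(ler_nat R) -lee_fin => <-.
rewrite /first_points natr_sum -sumEFin -(big_mkord xpredT
  (fun n => ((X n w \in B)%:R)%:E)).
by apply: nneseries_lim_ge => n _ _; rewrite lee_fin.
Qed.

(** The truncated counts are nondecreasing integers bounded by [k]. If all stayed below [k], the
    series would be at most [k - 1]; so [k] is reached, and then kept. *)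
Lemma first_points_near (B : set (R * R)) w k :
  point_count X B w = k%:R%:E -> \forall N \near \oo, first_points B N w = k.
Proof.
move=> Xk; have le := fun N => first_points_le N Xk.
have [N Nk] : exists N, first_points B N w = k.
  apply: contrapT => /forallNP h.
  have lt N : (first_points B N w < k)%N.
    by rewrite ltn_neqAle le andbT; apply/eqP; exact: h.
  case: k => [|k] in Xk h lt le *; first by have := lt 0%N.
  have : point_count X B w <= k%:R%:E.
    rewrite point_countE; apply: lime_le.
      by apply: is_cvg_nneseries => n _ _; rewrite lee_fin.
    apply: nearW => N; rewrite big_mkord sumEFin lee_fin -natr_sum ler_nat.
    by have := lt N; rewrite ltnS.
  by rewrite Xk lee_fin ler_nat ltnn.
exists N => // M /= NM; apply/eqP; rewrite eqn_leq le -Nk /first_points.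
rewrite -(big_mkord xpredT (fun n => (X n w \in B : nat))).
rewrite -(big_mkord xpredT (fun n => (X n w \in B : nat))).
by rewrite [leqRHS](@big_cat_nat _ _ _ N)//= leq_addr.
Qed.

End PointCount.

Lemma nneseries_only (R : realType) (f : nat -> R) k :
  (forall n, n != k -> f n = 0) -> 0 <= f k ->
  (\sum_(n <oo) (f n)%:E = (f k)%:E)%E.
Proof.
move=> f0 fk; have f_ge0 n : 0 <= f n.
  by have [->//|nk] := eqVneq n k; rewrite f0.
rewrite (@nneseriesD1 _ _ k)//; last by move=> n _; rewrite lee_fin.
by rewrite eseries0 ?adde0// => n _ /= nk; rewrite f0.
Qed.

(** The generating function at [c] of the Poisson law of mean [x]: the exponential series at
    [c * x], damped by [expR (- x)]. *)
Lemma nneseries_poisson (R : realType) (c x : R) : 0 <= c -> 0 <= x ->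
  (\sum_(k <oo) (c ^+ k * (x ^+ k / k`!%:R * expR (- x)))%:E
   = (expR (- ((1 - c) * x)))%:E)%E.
Proof.
move=> c0 x0.
have -> : expR (- ((1 - c) * x)) = expR (- x) * expR (c * x).
  by rewrite -expRD; congr expR; ring.
transitivity (limn (fun n => (expR (- x) * series (exp_coeff (c * x)) n)%:E)).
  apply/congr_lim/funext => n; rewrite sumEFin /series/= mulr_sumr.
  congr _%:E; apply: eq_bigr => k _.
  by rewrite /exp_coeff/= exprMn; ring.
apply/cvg_lim => //; apply: cvg_EFin; first exact: nearW.
apply: cvgMr; exact: is_cvg_series_exp_coeff.
Qed.

(** * Generating functional of the Poisson process at simple functions *)

Section SimpleThinning.
Context d (Omega : measurableType d) (R : realType) (P : probability Omega R)
  (X : nat -> {RV P >-> (R * R)%type}) (mu : R).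
Hypotheses (PPP : homogeneous_PPP mu X) (mu0 : 0 <= mu).
Variables (m : nat) (B : 'I_m -> set (R * R)) (a : 'I_m -> R).
Hypotheses (mB : forall i, measurable (B i))
  (fB : forall i, (area (B i) < +oo)%E) (tB : trivIset setT B)
  (a0 : forall i, 0 <= a i) (a1 : forall i, a i <= 1).

Let simple (x : R * R) : R := \sum_(i < m) a i * \1_(B i) x.

Let A (i : 'I_m) k : set Omega := [set w | point_count X (B i) w = k%:R%:E].

Let mA i k : measurable (A i k).
Proof. exact: measurable_point_count. Qed.

Let A_inj i k k' w : A i k w -> A i k' w -> k = k'.
Proof. by rewrite /A/= => -> [] /eqP; rewrite eqr_nat => /eqP. Qed.

(** [c] to the power of the number of points in [B i], with value 0 when that number is infinite.
    This is the value of the series in [pgf_series], and it lets [pgf_le] hold everywhere. *)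
Let pgf (c : R) i w : R :=
  if pselect (exists k, A i k w) is left h then c ^+ projT1 (cid h) else 0.

Let pgfE c i w k : A i k w -> pgf c i w = c ^+ k.
Proof.
rewrite /pgf; case: pselect => [h|h] Ak; last by absurd False => //; apply: h; exists k.
by congr (_ ^+ _); apply: A_inj Ak; case: (cid h).
Qed.

Let pgf_ge0 c i w : 0 <= c -> 0 <= pgf c i w.
Proof. by rewrite /pgf => c0; case: pselect => // h; exact: exprn_ge0. Qed.

Let pgf_series c i w : 0 <= c ->
  (\sum_(k <oo) (c ^+ k * \1_(A i k) w)%:E = (pgf c i w)%:E)%E.
Proof.
move=> c0; have [[k Ak]|h] := pselect (exists k, A i k w).
  rewrite (@nneseries_only _ _ k).
  - by rewrite indicE mem_set// mulr1 (pgfE _ Ak).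
  - move=> n nk; rewrite indicE memNset ?mulr0// => An.
    by move/eqP: nk; apply; exact: A_inj An Ak.
  - by rewrite mulr_ge0// exprn_ge0.
rewrite eseries0 => [|k _ _].
  by rewrite /pgf; case: pselect.
by rewrite indicE memNset ?mulr0// => Ak; apply: h; exists k.
Qed.

Let intensity i : R := mu * fine (area (B i)).

Let intensity_ge0 i : 0 <= intensity i.
Proof. by rewrite mulr_ge0// fine_ge0. Qed.

Let integral_pgf (c : 'I_m -> R) : (forall i, 0 <= c i) ->
  (\int[P]_w (\prod_i pgf (c i) i w)%:E =
   (\prod_i expR (- ((1 - c i) * intensity i)))%:E)%E.
Proof.
move=> c0.
apply: (@integral_prod_discrete _ _ _ P m A
  (fun i k => intensity i ^+ k / k`!%:R * expR (- intensity i))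
  (fun i k => c i ^+ k)).
- exact: mA.
- by move=> i k; exact: exprn_ge0.
- by move=> i k; rewrite mulr_ge0// ?expR_ge0// divr_ge0// exprn_ge0.
- by move=> k; rewrite PPP.
- by move=> i w; rewrite pgf_series.
- by move=> i; rewrite nneseries_poisson.
Qed.

Let finite_counts : set Omega := \bigcap_i \bigcup_k A i k.

Let measurable_finite_counts : measurable finite_counts.
Proof.
by apply: fin_bigcap_measurable => // i _; exact: bigcup_measurable.
Qed.

(** At [c = 1] the product of the [pgf] is the indicator of [finite_counts], owing to the default
    value 0, while its expectation is a product of [expR 0]. *)
Let P_finite_counts : P finite_counts = 1%E.
Proof.
rewrite -[finite_counts]setIT -integral_indic//.
transitivity (\int[P]_w (\prod_i pgf 1 i w)%:E)%E; last first.
  rewrite integral_pgf// big1// => i _.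
  by rewrite subrr mul0r oppr0 expR0.
apply: eq_integral => w _; congr _%:E; rewrite indicE.
have [/set_mem h|h] := boolP (w \in finite_counts).
  rewrite big1// => i _; have [k _ Ak] := h i I.
  by rewrite (pgfE _ Ak) expr1n.
have [i hi] : exists i, ~ exists k, A i k w.
  apply: contrapT => /forallNP nh; move/negP: h; apply; apply/mem_set => i _.
  by have /contrapT[k Ak] := nh i; exists k.
by rewrite (bigD1 i)//= {1}/pgf; case: pselect => //; rewrite mul0r.
Qed.

(** By disjointness of the [B i], at most one factor differs from 1. This converts a product over
    points into powers of counts. *)
Let oneB_simple x : 1 - simple x = \prod_i (1 - a i) ^+ (x \in B i).
Proof.
rewrite /simple; have [[i Bi]|h] := pselect (exists i, B i x).
  rewrite (bigD1 i)//= [in RHS](bigD1 i)//= indicE mem_set// mulr1 expr1.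
  have nB j : j != i -> x \in B j = false.
    move=> ji; apply/negbTE; rewrite notin_setE => Bj.
    by move/eqP: ji; apply; apply: tB => //; exists x.
  rewrite big1 ?addr0; last by move=> j ji; rewrite indicE nB// mulr0.
  by rewrite big1 ?mulr1// => j ji; rewrite nB.
have nB i : x \in B i = false.
  by apply/negbTE; rewrite notin_setE => Bi; apply: h; exists i.
rewrite big1 ?subr0; last by move=> i _; rewrite indicE nB mulr0.
by rewrite big1// => i _; rewrite nB.
Qed.

Let prod_simple N w : \prod_(n < N) (1 - simple (X n w)) =
  \prod_i (1 - a i) ^+ first_points X (B i) N w.
Proof.
transitivity (\prod_(n < N) \prod_i (1 - a i) ^+ (X n w \in B i)).
  by apply: eq_bigr => n _; exact: oneB_simple.
by rewrite exchange_big/=; apply: eq_bigr => i _; rewrite prodrXr.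
Qed.

Let mean : R := \prod_i expR (- (a i * intensity i)).

Let integral_pgf_mean : (\int[P]_w (\prod_i pgf (1 - a i) i w)%:E = mean%:E)%E.
Proof.
rewrite integral_pgf; last by move=> i; rewrite subr_ge0.
by congr _%:E; apply: eq_bigr => i _; congr expR; ring.
Qed.

Let pgf_le i w N : pgf (1 - a i) i w <= (1 - a i) ^+ first_points X (B i) N w.
Proof.
have c0 : 0 <= 1 - a i by rewrite subr_ge0.
have [[k Ak]|h] := pselect (exists k, A i k w); last first.
  by rewrite {1}/pgf; case: pselect => // _; exact: exprn_ge0.
by rewrite (pgfE _ Ak) ler_wiXn2l// ?lerBlDr ?lerDl//; exact: first_points_le.
Qed.

Let simple_ge0 x : 0 <= simple x.
Proof. by apply: sumr_ge0 => i _; rewrite mulr_ge0. Qed.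

Let simple_le1 x : simple x <= 1.
Proof.
by rewrite -subr_ge0 oneB_simple; apply: prodr_ge0 => i _; rewrite exprn_ge0// subr_ge0.
Qed.

Let measurable_simple : measurable_fun setT simple.
Proof.
rewrite /simple; under eq_fun do rewrite -big_enum/=.
by apply: measurable_sum => i; apply: measurable_funM.
Qed.

Let mprod N : measurable_fun setT (fun w => (\prod_(n < N) (1 - simple (X n w)))%:E).
Proof.
apply/measurable_EFinP; apply: measurable_prod => n _.
apply: measurable_funB => //; exact: (measurableT_comp measurable_simple).
Qed.

Let mpgf : measurable_fun setT (fun w => (\prod_i pgf (1 - a i) i w)%:E).
Proof.
apply/measurable_EFinP; apply: measurable_prod => i _; apply/measurable_EFinP.
rewrite (_ : _ \o _ = fun w => (\sum_(k <oo) ((1 - a i) ^+ k * \1_(A i k) w)%:E)%E); last first.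
  by apply/funext => w /=; rewrite pgf_series// subr_ge0.
apply: ge0_emeasurable_sum => [k w _ _|k _].
  by rewrite lee_fin mulr_ge0// exprn_ge0// subr_ge0.
by apply/measurable_EFinP; apply: measurable_funM => //; exact: measurable_indic.
Qed.

Let pgf_prod_ge0 w : 0 <= \prod_i pgf (1 - a i) i w.
Proof. by apply: prodr_ge0 => i _; apply: pgf_ge0; rewrite subr_ge0. Qed.

Let pgf_prod_le N w : \prod_i pgf (1 - a i) i w <= \prod_(n < N) (1 - simple (X n w)).
Proof.
rewrite prod_simple; apply: ler_prod => i _.
by rewrite pgf_le andbT; apply: pgf_ge0; rewrite subr_ge0.
Qed.

(** Truncation drops factors lying in [[0, 1]], so the value of the limit bounds the expectation
    from below for every [N]. This uniformity in [N] is what controls general functions. *)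
Lemma simple_thinning_ge N :
  (mean%:E <= \int[P]_w (\prod_(n < N) (1 - simple (X n w)))%:E)%E.
Proof.
rewrite -integral_pgf_mean; apply: ge0_le_integral => //.
- by move=> w _; rewrite lee_fin.
- by move=> w _; rewrite lee_fin.
Qed.

(** Almost surely all counts are finite, and then the truncated products are eventually constant;
    they are dominated by 1. *)
Lemma simple_thinning_cvg :
  (fun N => \int[P]_w (\prod_(n < N) (1 - simple (X n w)))%:E)%E @ \oo --> mean%:E.
Proof.
rewrite -integral_pgf_mean.
have [] := @dominated_convergence _ _ _ P setT measurableT
  (fun N w => (\prod_(n < N) (1 - simple (X n w)))%:E)
  (fun w => (\prod_i pgf (1 - a i) i w)%:E) (cst 1%E) mprod mpgf => //.
- exists (~` finite_counts); split.
  + exact: measurableC.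
  + by have := probability_setC P measurable_finite_counts; rewrite P_finite_counts subee.
  + move=> w /= h Aw; apply: h => _.
    have /choice[k Ak] : forall i, exists k, A i k w.
      by move=> i; have [k _ Ak] := Aw i I; exists k.
    apply: cvg_near_cst.
    have : \forall N \near \oo, forall i, first_points X (B i) N w = k i.
      by apply: filter_forall => i; exact: (first_points_near (Ak i)).
    apply: filterS => N Nk; rewrite prod_simple; congr _%:E.
    by apply: eq_bigr => i _; rewrite (pgfE _ (Ak i)) Nk.
- exact: finite_measure_integrable_cst.
- apply: aeW => w N _ /=; rewrite lee_fin ger0_norm.
    apply: prodr_ile1 => n _; rewrite subr_ge0 lerBlDr lerDl.
    by rewrite simple_le1 simple_ge0.
  exact: le_trans (pgf_prod_ge0 w) (pgf_prod_le N w).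
Qed.

End SimpleThinning.

(** Factors are replaced one at a time; as all of them lie in [[0, 1]], each replacement costs at
    most [e]. *)
Lemma ler_prod_perturb (R : realDomainType) (N : nat) (u v : 'I_N -> R) (e : R) :
  (forall k, 0 <= u k) -> (forall k, u k <= v k) -> (forall k, v k <= 1) ->
  (forall k, v k <= u k + e) -> \prod_k v k <= \prod_k u k + N%:R * e.
Proof.
elim: N u v => [|N IH] u v u0 uv v1 ve; first by rewrite !big_ord0 mul0r addr0.
rewrite !big_ord_recr/=.
set pv := \prod_(i < N) _; set pu := \prod_(i < N) _.
have : pv <= pu + N%:R * e by apply: IH => k; [exact: u0|exact: uv|exact: v1|exact: ve].
have pu0 : 0 <= pu by apply: prodr_ge0.
have pu1 : pu <= 1 by apply: prodr_ile1 => i _; rewrite u0 (le_trans (uv _)).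
have upv : pu <= pv by apply: ler_prod => i _; rewrite u0 uv.
have := u0 ord_max; have := uv ord_max; have := v1 ord_max; have := ve ord_max.
move: (u ord_max) (v ord_max) => x y; rewrite -natr1 => h1 h2 h3 h4 h5.
have e0 : 0 <= e by lra.
have : pv * y - pu * x <= (pv - pu) + e.
  have -> : pv * y - pu * x = (pv - pu) * y + pu * (y - x) by ring.
  by apply: lerD; [rewrite ler_piMr//; lra|nra].
by rewrite mulrDl mul1r; lra.
Qed.

(** * Generating functional of the Poisson process at integrable functions *)

Section PGFL.
Context d (Omega : measurableType d) (R : realType) (P : probability Omega R)
  (X : nat -> {RV P >-> (R * R)%type}) (mu : R).
Hypotheses (PPP : homogeneous_PPP mu X) (mu0 : 0 <= mu).
Variables (h : R * R -> R) (H : R).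
Local Notation plane := (@lebesgue_measure R \x @lebesgue_measure R)%E.
Hypotheses (mh : measurable_fun setT h) (h0 : forall x, 0 <= h x)
  (h1 : forall x, h x <= 1) (hH : (\int[plane]_x (h x)%:E = H%:E)%E).

(* [hs n] rounds [h] down to a multiple of [1 / (n + 1)]. *)
Let B n (i : 'I_n.+1) := [set x | i.+1%:R <= n.+1%:R * h x < i.+2%:R].
Let a n (i : 'I_n.+1) : R := i.+1%:R / n.+1%:R.
Let hs n x := \sum_(i < n.+1) a i * \1_(B i) x.

Let mB n (i : 'I_n.+1) : measurable (B i).
Proof.
have mf : measurable_fun setT (fun x => n.+1%:R * h x) by exact: measurable_funM.
have := mf measurableT `[i.+1%:R, i.+2%:R[%classic (measurable_itv _).
by rewrite setTI.
Qed.

Let a0 n (i : 'I_n.+1) : 0 <= a i. Proof. by rewrite divr_ge0. Qed.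

Let a1 n (i : 'I_n.+1) : a i <= 1.
Proof. by rewrite ler_pdivrMr// mul1r ler_nat. Qed.

Let tB n : trivIset setT (@B n).
Proof.
move=> i j _ _ [x [/andP[i1 i2] /andP[j1 j2]]]; apply/val_inj/eqP => /=.
have := le_lt_trans i1 j2; have := le_lt_trans j1 i2.
by rewrite !ltr_nat !ltnS => ? ?; rewrite eqn_leq; apply/andP.
Qed.

Let hsE n x : hs n x <= h x /\ h x <= hs n x + n.+1%:R^-1.
Proof.
have n0 : 0 < n.+1%:R :> R by [].
rewrite /hs; have [small|big] := ltP (n.+1%:R * h x) 1.
  rewrite big1 => [|i _].
    split => //; rewrite add0r -(ler_pM2l n0) mulfV ?gt_eqF//; exact: ltW.
  rewrite indicE memNset ?mulr0// => /andP[+ _]; apply/negP; rewrite -ltNge.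
  by rewrite (lt_le_trans small)// ler1n.
have hx0 : 0 <= n.+1%:R * h x by rewrite mulr_ge0.
(* Here [1 <= k <= n + 1], since [h x <= 1]; the level [k / (n + 1)] has index [k - 1]. *)
have := truncn_itv hx0; set k := Num.truncn _ => /andP[k1 k2].
have k0 : (0 < k)%N by rewrite -ltnS -(ltr_nat R) (le_lt_trans big).
have kn : (k.-1 < n.+1)%N.
  rewrite prednK// -(ler_nat R) (le_trans k1)//.
  by rewrite ler_piMr.
have Bk : B (Ordinal kn) x by rewrite /B/= prednK// k1 k2.
have nB (j : 'I_n.+1) : j != Ordinal kn -> \1_(B j) x = 0 :> R.
  move=> jk; rewrite indicE memNset// => Bj; move/eqP: jk; apply.
  by apply: (@tB n) => //; exists x.
rewrite (bigD1 (Ordinal kn))//= big1 ?addr0; last first.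
  by move=> j jk; rewrite nB// mulr0.
rewrite indicE mem_set// mulr1 /a/= prednK//.
rewrite -(ler_pM2l n0) mulrCA divff ?gt_eqF// mulr1; split => //.
rewrite -(ler_pM2l n0) mulrDr mulrCA divff ?gt_eqF// mulr1.
by rewrite natr1 ltW.
Qed.

Let mhs n : measurable_fun setT (hs n).
Proof.
by apply: measurable_sum => i; apply: measurable_funM => //; exact: (measurable_indic (mB i)).
Qed.

Let hs0 n x : 0 <= hs n x.
Proof. by apply: sumr_ge0 => i _; rewrite mulr_ge0. Qed.

Let mEh : measurable_fun setT (EFin \o h). Proof. exact/measurable_EFinP. Qed.

(** Markov's inequality: [h >= a i > 0] on [B i]. This is why the level 0, whose set may have
    infinite area, is not among the [B i]. *)
Let fB n (i : 'I_n.+1) : (area (B i) < +oo)%E.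
Proof.
have ai0 : 0 < a i by rewrite divr_gt0.
rewrite -(@lte_pmul2l _ (a i)%:E)// gt0_muley// -/(area _).
apply: (@le_lt_trans _ _ H%:E); last exact: ltry.
rewrite -hH /area -[B i]setIT -integral_indic; [|by []|exact: mB].
rewrite -(@ge0_integralZl_EFin _ _ _ plane setT measurableT (fun x => (\1_(B i) x)%:E))//; last first.
  by apply/measurable_EFinP; exact: (measurable_indic (mB i)).
apply: ge0_le_integral => //.
- by move=> x _; rewrite mule_ge0// lee_fin.
- by apply/measurable_EFinP; apply: measurable_funM => //; exact: (measurable_indic (mB i)).
- move=> x _; rewrite -EFinM lee_fin; apply: le_trans (hsE n x).1.
  rewrite /hs (bigD1 i)//= lerDl.
  by apply: sumr_ge0 => j _; rewrite mulr_ge0.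
Qed.

Let Hs n : R := \sum_(i < n.+1) a i * fine (area (B i)).

Let integral_hs n : (\int[plane]_x (hs n x)%:E = (Hs n)%:E)%E.
Proof.
under eq_integral do rewrite -sumEFin.
rewrite ge0_integral_sum//; last 2 first.
- by move=> i; apply/measurable_EFinP; apply: measurable_funM => //; exact: (measurable_indic (mB i)).
- by move=> i x _; rewrite lee_fin mulr_ge0.
rewrite -sumEFin; apply: eq_bigr => i _.
under eq_integral do rewrite EFinM.
rewrite ge0_integralZl_EFin//; last by apply/measurable_EFinP; exact: (measurable_indic (mB i)).
rewrite integral_indic; [|by []|exact: mB].
rewrite setIT; transitivity ((a i)%:E * area (B i))%E => //.
by rewrite [RHS]EFinM fineK// ge0_fin_numE ?fB// /area measure_ge0.
Qed.

Let Hs_le n : Hs n <= H.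
Proof.
rewrite -lee_fin -integral_hs -hH; apply: ge0_le_integral => //.
- by move=> x _; rewrite lee_fin.
- by apply/measurable_EFinP; exact: mhs.
- by move=> x _; rewrite lee_fin; exact: (hsE n x).1.
Qed.

Let Hs_cvg : Hs n @[n --> \oo] --> H.
Proof.
suff : ((Hs n)%:E @[n --> \oo] --> H%:E)%E by move=> /fine_cvgP[].
rewrite -hH; under eq_fun do rewrite -integral_hs.
apply: (@dominated_cvg _ _ _ plane setT measurableT
  (fun n x => (hs n x)%:E) (fun x => (h x)%:E) (fun x => (h x)%:E)) => //.
- by move=> n; apply/measurable_EFinP; exact: mhs.
- move=> x _; apply: cvg_EFin; first exact: nearW.
  apply: (@squeeze_cvgr _ _ _ _ (fun n => h x - harmonic n) (cst (h x))).
  + by apply: nearW => n; rewrite lerBlDr (hsE n x).1 (hsE n x).2.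
  + by rewrite -[X in _ --> X]subr0; apply: cvgB; [exact: cvg_cst|exact: cvg_harmonic].
  + exact: cvg_cst.
- apply/integrableP; split => //; under eq_integral do rewrite gee0_abs ?lee_fin//.
  by rewrite hH ltry.
- by move=> n x _; rewrite lee_fin ger0_norm//; exact: (hsE n x).1.
Qed.

Let V N : \bar R := (\int[P]_w (\prod_(k < N) (1 - h (X k w)))%:E)%E.

Let W n N : \bar R := (\int[P]_w (\prod_(k < N) (1 - hs n (X k w)))%:E)%E.

Let W_mean n : expR (- (mu * Hs n)) =
  \prod_(i < n.+1) expR (- (a i * (mu * fine (area (B i))))).
Proof.
rewrite -expR_sum sumrN /Hs mulr_sumr; congr (expR (- _)).
by apply: eq_bigr => i _; rewrite mulrCA.
Qed.

Let W_ge n N : ((expR (- (mu * Hs n)))%:E <= W n N)%E.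
Proof. by rewrite W_mean; exact: simple_thinning_ge. Qed.

Let W_cvg n : W n N @[N --> \oo] --> (expR (- (mu * Hs n)))%:E.
Proof. by rewrite W_mean; exact: simple_thinning_cvg. Qed.

Let mprod (g : R * R -> R) N : measurable_fun setT g ->
  measurable_fun setT (fun w => (\prod_(k < N) (1 - g (X k w)))%:E).
Proof.
move=> mg; apply/measurable_EFinP; apply: measurable_prod => k _.
by apply: measurable_funB => //; exact: (measurableT_comp mg).
Qed.

Let hs1 n x : hs n x <= 1. Proof. exact: le_trans (hsE n x).1 (h1 x). Qed.

Let V_ge0 N : (0 <= V N)%E.
Proof.
by apply: integral_ge0 => w _; rewrite lee_fin; apply: prodr_ge0 => k _; rewrite subr_ge0.
Qed.

Let V_le_W n N : (V N <= W n N)%E.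
Proof.
apply: ge0_le_integral => //.
- by move=> w _; rewrite lee_fin; apply: prodr_ge0 => k _; rewrite subr_ge0.
- exact: mprod.
- exact: mprod.
- move=> w _; rewrite lee_fin; apply: ler_prod => k _.
  by rewrite subr_ge0 h1 lerB//; exact: (hsE n _).1.
Qed.

Let V_fin N : V N \is a fin_num.
Proof.
rewrite ge0_fin_numE//; apply: (@le_lt_trans _ _ 1%E); last exact: ltry.
rewrite -(probability_setT P) -[leRHS]mul1e -integral_cst//.
apply: ge0_le_integral => //.
- by move=> w _; rewrite lee_fin; apply: prodr_ge0 => k _; rewrite subr_ge0.
- exact: mprod.
- move=> w _; rewrite lee_fin; apply: prodr_ile1 => k _.
  by rewrite subr_ge0 h1 lerBlDr lerDl h0.
Qed.

Let W_le_V n N : (W n N <= V N + (N%:R * n.+1%:R^-1)%:E)%E.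
Proof.
have -> : (N%:R * n.+1%:R^-1)%:E = (\int[P]_w (N%:R * n.+1%:R^-1)%:E)%E.
  by rewrite integral_cst// [X in (_ * X)%E](probability_setT P) mule1.
rewrite -ge0_integralD//; last 2 first.
- by move=> w _; rewrite lee_fin; apply: prodr_ge0 => k _; rewrite subr_ge0.
- exact: mprod.
apply: ge0_le_integral => //.
- by move=> w _; rewrite lee_fin; apply: prodr_ge0 => k _; rewrite subr_ge0.
- exact: mprod.
- by apply: emeasurable_funD => //; exact: mprod.
- move=> w _; rewrite -EFinD lee_fin; apply: ler_prod_perturb => k.
  + by rewrite subr_ge0.
  + by rewrite lerB//; exact: (hsE n _).1.
  + by rewrite lerBlDr lerDl.
  + move: (hsE n (X k w)).2; move: (hs n (X k w)) (h (X k w)) (n.+1%:R^-1).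
    by move=> x y z; lra.
Qed.

(* The expectation at [h] is squeezed between [W n N - N / (n + 1)] and
   [W n N], where [W n N] is the expectation at [hs n]. *)
Lemma PPP_pgfl :
  (fun N => \int[P]_w (\prod_(k < N) (1 - h (X k w)))%:E)%E @ \oo -->
  (expR (- (mu * H)))%:E.
Proof.
set L := expR _.
(* At fixed [N] the rounding is refined: the lower bound on [W n N] is uniform in [N], and the error
   [N / (n + 1)] vanishes as [n] grows. *)
have Lle N : L <= fine (V N).
  have le n : L <= fine (V N) + N%:R * harmonic n.
    rewrite -lee_fin EFinD fineK//; apply: le_trans (W_le_V n N).
    apply: le_trans (W_ge n N); rewrite lee_fin ler_expR lerN2.
    by apply: ler_wpM2l.
  have cvg : (fine (V N) + N%:R * harmonic n) @[n --> \oo] --> fine (V N).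
    rewrite -[X in _ --> X]addr0 -(mulr0 N%:R); apply: cvgD; first exact: cvg_cst.
    by apply: cvgM; [exact: cvg_cst|exact: cvg_harmonic].
  by apply: (cvgr_to_ge cvg); exact: nearW.
have Hcvg : expR (- (mu * Hs n)) @[n --> \oo] --> L.
  apply: (@continuous_cvg _ _ _ _ _ (fun n => - (mu * Hs n)) expR).
    exact: continuous_expR.
  by apply: cvgN; apply: cvgM => //; exact: cvg_cst.
apply/fine_cvgP; split; first exact: nearW.
apply/cvgrPdist_lt => e e0.
(* For the upper bound [n] is chosen first, so that the limit of [W n N] in [N] is below [L + e];
   then [N] is taken large. *)
have [n _ /(_ n (leqnn n))/= Hn] := cvgr_lt L Hcvg (L + e) (ltr_pwDr e0 (lexx L)).
have /fine_cvgP[fW /cvgr_lt /(_ _ Hn) lt] := @W_cvg n.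
near=> N.
rewrite ltr_distlC; apply/andP; split.
  by rewrite ltrBlDr (le_lt_trans (Lle N))// ltrDl.
rewrite [fine _](_ : _ = fine (V N))//.
apply: (@le_lt_trans _ _ (fine (W n N))); last by near: N.
by apply: fine_le => //; near: N.
Unshelve. all: by end_near. Qed.

End PGFL.

(** * Void probabilities of the marked process *)

Section VoidProbability.
Context d (Omega : measurableType d) (R : realType) (P : probability Omega R)
  (mu : R) (X : nat -> {RV P >-> (R * R)%type}) (L Phi : nat -> {RV P >-> R}).
Hypotheses (mu0 : 0 <= mu) (model : segment_boolean_model mu X L Phi).
Local Open Scope ereal_scope.

(* The law of the orientation is written [distribution P (Phi 0%N)] because
   [uniform_prob] lives on [measurableTypeR R], whose display differs from that
   of [R]. *)
Definition mark_law : probability (R * R)%type R :=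
  (distribution P (L 0%N) : probability R R) \x
  (distribution P (Phi 0%N) : probability R R).

Let germs := \bigcup_n sigma_RV (X n).
(** [Omega] with the coarser sigma-algebra generated by the centers. The identity into it serves as
    the germ variable [p], so no space of point configurations is needed. *)
Let T1 := g_sigma_algebraType germs.

Let germs_measurable U : <<s germs >> U -> measurable U.
Proof.
apply: smallest_sub; first exact: sigma_algebra_measurable.
move=> A [n _ [B mB ->]]; rewrite -[X in measurable X]setTI.
exact: measurable_funP.
Qed.

Let mid : measurable_fun setT (idfun : Omega -> T1).
Proof. by move=> _ U mU; rewrite setTI; exact: germs_measurable. Qed.

Let mX n : measurable_fun setT (X n : T1 -> (R * R)%type).
Proof.
move=> _ B mB; rewrite setTI; apply: sub_sigma_algebra.
by exists n => //; exists B.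
Qed.

(** Mutual independence for the finite family made of the centers and the first [N] lengths and
    orientations; identical laws then replace the law of each mark by that of mark 0. *)
Let marks_independent N U C D : <<s germs >> U -> (forall n, measurable (C n)) ->
  (forall n, measurable (D n)) ->
  P (U `&` \bigcap_(n < N) (L n @^-1` C n `&` Phi n @^-1` D n)) =
  P U * (\prod_(n < N) (fine (distribution P (L 0%N) (C n)) *
                        fine (distribution P (Phi 0%N) (D n))))%:E.
Proof.
move=> mU mC mD.
pose E (j : option (nat + nat)) := match j with
  | None => U | Some (inl n) => L n @^-1` C n | Some (inr n) => Phi n @^-1` D n end.
pose s : seq (option (nat + nat)) := None ::
  ([seq Some (inl n) | n <- iota 0 N] ++ [seq Some (inr n) | n <- iota 0 N]).
have us : uniq s.
  rewrite cons_uniq mem_cat negb_or cat_uniq.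
  rewrite !map_inj_uniq ?iota_uniq//=; [|by move=> ? ? []..].
  rewrite andbT; apply/andP; split.
    by apply/andP; split; apply/mapP => -[].
  by apply/hasPn => x /mapP[n _ ->]; apply/mapP => -[].
have sE j : (j \in seq_fset tt s) = (j \in s) by rewrite seq_fsetE.
have := @germs_marks_independent _ _ _ _ _ _ _ _ model (seq_fset tt s) E.
have -> : \bigcap_(j in [set` seq_fset tt s]) E j =
    U `&` \bigcap_(n < N) (L n @^-1` C n `&` Phi n @^-1` D n).
  apply/seteqP; split => [w h|w [Uw h] [[n|n]|]//=].
  - split; first by have /= := h None; rewrite sE => /(_ (mem_head _ _)).
    move=> n /= nN; split.
      have /= := h (Some (inl n)); rewrite sE; apply.
      by rewrite inE mem_cat map_f ?orbT// mem_iota.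
    have /= := h (Some (inr n)); rewrite sE; apply.
    by rewrite inE mem_cat (map_f (fun n => Some (inr n))) ?orbT// mem_iota.
  - rewrite sE inE mem_cat /= => /orP[/mapP[k]|/mapP[k _]//].
    by rewrite mem_iota add0n => /= kN [->]; have [] := h k kN.
  - rewrite sE inE mem_cat /= => /orP[/mapP[k _]//|/mapP[k]].
    by rewrite mem_iota add0n => /= kN [->]; have [] := h k kN.
move=> -> /=; last first.
  move=> [[n|n]|] _ /=; [by exists (C n)|by exists (D n)|exact: mU].
rewrite (perm_big s); last first.
  by apply: uniq_perm; [exact: sort_keys_uniq|exact: us|exact: sort_keysE].
rewrite big_cons big_cat/= !big_map.
have -> : iota 0 N = index_iota 0 N by rewrite /index_iota subn0.
rewrite !big_mkord; congr (_ * _).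
rewrite big_split/= EFinM -!prodEFin.
congr (_ * _).
  apply: eq_bigr => n _.
  rewrite -(lengths_identically_distributed model n (mC n)).
  by rewrite fineK// fin_num_measure.
apply: eq_bigr => n _.
rewrite (orientations_uniform model 0%N)// -(orientations_uniform model n)//.
by rewrite fineK// fin_num_measure.
Qed.

Variables (S : set ((R * R) * (R * R))) (H : R).
Hypotheses (mS : measurable S)
  (SH : \int[@lebesgue_measure R \x @lebesgue_measure R]_x mark_law (xsection S x) = H%:E).

Lemma void_probability :
  P [set w | forall n, ~ S (X n w, (L n w, Phi n w))] = (expR (- (mu * H)))%:E.
Proof.
pose h x := fine (mark_law (xsection S x)).
have mSx x : measurable (xsection S x) by exact: measurable_xsection.
have hE x : (h x)%:E = mark_law (xsection S x) by rewrite fineK// fin_num_measure.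
have mh : measurable_fun setT h.
  exact: (measurableT_comp (fine_measurable measurableT)
    (measurable_fun_xsection mark_law mS)).
have h0 x : (0 <= h x)%R by exact: fine_ge0.
have h1 x : (h x <= 1)%R by rewrite -lee_fin hE probability_le1.
have hH : \int[@lebesgue_measure R \x @lebesgue_measure R]_x (h x)%:E = H%:E.
  by rewrite -SH; apply: eq_integral => x _; exact: hE.
have pgfl := PPP_pgfl (centers_PPP model) mu0 mh h0 h1 hH.
pose F N := \bigcap_(n < N) [set w | ~ S (X n w, (L n w, Phi n w))].
have mF N : measurable (F N).
  apply: fin_bigcap_measurable => // n _.
  have mXLP : measurable_fun setT (fun w => (X n w, (L n w, Phi n w))).
    by apply: measurable_fun_pair => //; exact: measurable_fun_pair.
  by rewrite -[X in measurable X]setTI; exact: (mXLP measurableT _ (measurableC mS)).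
have PF N : P (F N) = \int[P]_w (\prod_(k < N) (1 - h (X k w)))%:E.
  (* The germ variable holds all the centers, so the set depends on [n]. Its section is the
     complement of the section of [S] at [X n w], of mass [1 - h (X n w)]. *)
  pose S' n : set (T1 * (R * R)) := [set z | ~ S (X n z.1, z.2)].
  have mS' n : measurable (S' n).
    have mXz : measurable_fun setT (fun z : T1 * (R * R) => (X n z.1, z.2)).
      by apply: measurable_fun_pair => //; exact: (measurableT_comp (mX n) measurable_fst).
    by rewrite -[X in measurable X]setTI; exact: (mXz measurableT _ (measurableC mS)).
  have := @marking _ _ _ _ _ T1 _ _ _ P (distribution P (L 0%N))
    (distribution P (Phi 0%N)) (idfun : Omega -> T1) L Phi mid
    (fun n => measurable_funP _) (fun n => measurable_funP _) marks_independent
    N S' (cst 1) mS' (measurable_cst _) (fun=> lee01).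
  rewrite integral_cst ?mul1e; last exact: mF.
  move=> ->; apply: eq_integral => w _; rewrite /= mul1e; congr _%:E.
  apply: eq_bigr => n _.
  have -> : xsection (S' n) w = ~` xsection S (X n w).
    by apply/seteqP; split => y; rewrite !xsectionE.
  have := probability_setC mark_law (mSx (X n w)).
  by rewrite /= => ->; rewrite -hE.
have FE : [set w | forall n, ~ S (X n w, (L n w, Phi n w))] = \bigcap_N F N.
  by apply/seteqP; split => [w h2 N _ n _|w h2 n]; [exact: h2|exact: (h2 n.+1 I n (ltnSn n))].
have cvgF : P (F N) @[N --> \oo] --> P (\bigcap_N F N).
  apply: nonincreasing_cvg_mu => //.
  - by rewrite (le_lt_trans (probability_le1 _ _))// ltry.
  - exact: bigcap_measurable.
  - move=> m n mn; apply/subsetPset => w Fw k km; apply: Fw.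
    exact: leq_trans km mn.
rewrite FE -(cvg_lim _ cvgF)//; apply/cvg_lim => //.
by rewrite (_ : (fun N => P (F N)) = (fun N => \int[P]_w (\prod_(k < N) (1 - h (X k w)))%:E))//;
  apply/funext.
Qed.

End VoidProbability.

(** * Affine changes of variables and areas of parallelograms *)

Section Parallelogram.
Context (R : realType).
Local Notation leb := (@lebesgue_measure R).
Local Open Scope ereal_scope.

Let maffine (a b : R) : measurable_fun setT (fun x : R => (a * x + b)%R).
Proof. by apply: measurable_funD => //; exact: measurable_funM. Qed.

Let pushforward_affine (a b : R) : {measure set (measurableTypeR R) -> \bar R} :=
  measure_function_pushforward__canonical__measure_function_Measure
    leb (maffine a b : measurable_fun setT (_ : measurableTypeR R -> measurableTypeR R)).

(** The image of Lebesgue measure under the affine map, multiplied by [|a|], gives every interval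
    []u, v]] its length, and this determines it. A negative slope only moves the closed end. *)
Lemma lebesgue_measure_affine (a b : R) (A : set R) : a != 0%R -> measurable A ->
  leb [set x | A (a * x + b)%R] = (`|a|^-1)%:E * leb A.
Proof.
move=> a0 mA.
have na : (0 < `|a|)%R by rewrite normr_gt0.
have k0 : (0 <= `|a|)%R by [].
suff -> : leb A = mscale (NngNum k0) (pushforward_affine a b) A.
  by rewrite /mscale/= /pushforward muleA -EFinM mulVf ?gt_eqF// mul1e.
apply: lebesgue_measure_unique => // X [[u v] /= _ <-].
rewrite /mscale /= /pushforward /=.
have [ap|an] := ltP 0%R a.
  rewrite (_ : _ @^-1` _ = `]((u - b) / a)%R, ((v - b) / a)%R]%classic); last first.
    apply/seteqP; split => x; rewrite /= !in_itv/= ltr_pdivrMr// ler_pdivlMr//.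
      by rewrite ltrBlDr lerBrDr mulrC.
    by rewrite ltrBlDr lerBrDr mulrC.
  rewrite !lebesgue_measure_itv/= !lte_fin ltr_pM2r ?invr_gt0// ltrD2r.
  case: ifPn => _; last by rewrite mule0.
  rewrite -!EFinB -EFinM gtr0_norm//; congr _%:E.
  by field.
have {}an : (a < 0)%R by rewrite lt_neqAle a0.
rewrite (_ : _ @^-1` _ = `[((v - b) / a)%R, ((u - b) / a)%R[%classic); last first.
  apply/seteqP; split => x; rewrite /= !in_itv/= ltr_ndivlMr// ler_ndivrMr//.
    by rewrite ltrBlDr lerBrDr mulrC andbC.
  by rewrite ltrBlDr lerBrDr mulrC andbC.
rewrite !lebesgue_measure_itv/= !lte_fin ltr_nM2r ?invr_lt0// ltrD2r.
case: ifPn => _; last by rewrite mule0.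
rewrite -!EFinB -EFinM ltr0_norm//; congr _%:E.
by field.
Qed.

Lemma ge0_integral_affine (a b : R) (f : R -> \bar R) : a != 0%R ->
  measurable_fun setT f -> (forall x, 0 <= f x) ->
  \int[leb]_x f (a * x + b)%R = (`|a|^-1)%:E * \int[leb]_x f x.
Proof.
move=> a0 mf f0.
have k0 : (0 <= `|a|^-1)%R by rewrite invr_ge0.
rewrite -[LHS](@ge0_integral_pushforward _ _ (measurableTypeR R) (measurableTypeR R) _ _ (maffine a b) leb setT f)//.
rewrite -(@ge0_integral_mscale _ _ _ leb setT measurableT (NngNum k0))//.
apply: (@eq_measure_integral _ _ _ _ (mscale (NngNum k0) leb)
  (pushforward_affine a b)) => A mA _.
exact: lebesgue_measure_affine.
Qed.

(** Tonelli and two one-dimensional substitutions, whose slopes multiply to the determinant up to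
    sign. If [b = 0] the inner slope is [d] and the outer one is [a]. *)
Lemma area_parallelogram (a b c d : R) (A B : set R) :
  measurable A -> measurable B -> (a * d - b * c)%R != 0%R ->
  area [set z | A (a * z.1 + b * z.2)%R /\ B (c * z.1 + d * z.2)%R] =
  (`|a * d - b * c|^-1)%:E * (leb A * leb B).
Proof.
move=> mA mB det0.
have mlin (s t : R) : measurable_fun setT (fun z : R * R => (s * z.1 + t * z.2)%R).
  by apply: measurable_funD; apply: measurable_funM.
have mind (C : set R) (s t : R) : measurable C ->
    measurable_fun setT (fun z : R * R => (\1_C (s * z.1 + t * z.2)%R : R)%:E).
  move=> mC; apply/measurable_EFinP.
  exact: (measurableT_comp (measurable_indic mC) (mlin s t)).
have mind1 (C : set R) (s t : R) : measurable C ->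
    measurable_fun setT (fun x : R => (\1_C (s * x + t)%R : R)%:E).
  move=> mC; apply/measurable_EFinP.
  exact: (measurableT_comp (measurable_indic mC) (maffine s t)).
have int1 (C : set R) (s t : R) : measurable C -> s != 0%R ->
    \int[leb]_x (\1_C (s * x + t)%R)%:E = (`|s|^-1)%:E * leb C.
  move=> mC s0; rewrite (@ge0_integral_affine s t (fun x => (\1_C x)%:E))//; last first.
    by apply/measurable_EFinP; exact: measurable_indic.
  by rewrite integral_indic// setIT.
set S := [set z | _].
have mS : measurable S.
  have := measurableI _ _ (mlin a b measurableT A mA) (mlin c d measurableT B mB).
  by rewrite !setTI.
have areaE : area S = \int[leb]_x \int[leb]_y
    ((\1_A (a * x + b * y)%R)%:E * (\1_B (c * x + d * y)%R)%:E).
  rewrite /area/= /product_measure1; apply: eq_integral => x _ /=.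
  have mSx : measurable (xsection S x) by exact: measurable_xsection.
  rewrite -[xsection S x]setIT -integral_indic//.
  apply: eq_integral => y _; rewrite -EFinM -[in RHS]/(_ * _)%R; congr _%:E.
  rewrite !indicE -natrM mulnb; congr (_%:R); congr nat_of_bool.
  by rewrite mem_xsection; apply/idP/andP => [/set_mem[? ?]|[/set_mem ? /set_mem ?]];
    [split; exact/mem_set|apply/mem_set; split].
rewrite areaE.
have [b0|b0] := eqVneq b 0%R.
  have [a0 d0] : a != 0%R /\ d != 0%R.
    by apply/andP; move: det0; rewrite b0 mul0r subr0 mulf_eq0 negb_or.
  transitivity (\int[leb]_x ((\1_A (a * x + 0)%R)%:E * ((`|d|^-1)%:E * leb B))).
    apply: eq_integral => x _; rewrite b0.
    under eq_integral do rewrite mul0r [(c * x + _)%R]addrC.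
    by rewrite ge0_integralZl//= ?int1//; exact: mind1.
  rewrite ge0_integralZr//; last 2 first.
  - exact: mind1.
  - by rewrite mule_ge0.
  rewrite int1// b0 mul0r subr0 normrM invfM EFinM.
  by rewrite !muleA; congr (_ * _); rewrite -!muleA; congr (_ * _); rewrite muleC.
have e0 : (c - a * d / b)%R != 0%R.
  apply: contra det0 => /eqP e; apply/eqP.
  have -> : (a * d - b * c = - b * (c - a * d / b))%R by field.
  by rewrite e mulr0.
(* The substitution [v = a * x + b * y] frees the condition on [A] from [x]. After exchanging the
   integrals, the condition on [B] has slope [c - a * d / b] in [x], and [b] times this slope is
   minus the determinant. *)
transitivity (\int[leb]_x ((`|b|^-1)%:E * \int[leb]_v
    ((\1_A v)%:E * (\1_B ((c - a * d / b) * x + d / b * v)%R)%:E))).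
  apply: eq_integral => x _.
  rewrite -(@ge0_integral_affine b (a * x) (fun v =>
    (\1_A v)%:E * (\1_B ((c - a * d / b) * x + d / b * v)%R)%:E))//.
  - apply: eq_integral => y _; congr ((\1_A _)%:E * (\1_B _)%:E).
      by rewrite addrC.
    by field.
  - apply: emeasurable_funM; first exact/measurable_EFinP/measurable_indic.
    by under eq_fun do rewrite addrC; exact: mind1.
have mF : measurable_fun setT (fun z : R * R =>
    ((\1_A z.2)%:E * (\1_B ((c - a * d / b) * z.1 + d / b * z.2)%R)%:E) : \bar R).
  apply: emeasurable_funM; last exact: mind.
  apply/measurable_EFinP; exact: (measurableT_comp (measurable_indic mA) measurable_snd).
rewrite ge0_integralZl//; last 2 first.
- have mG := @measurable_fun_fubini_tonelli_F _ _ _ _ _ leb _ mF.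
  apply: mG => z; rewrite mule_ge0//.
- by move=> x _; apply: integral_ge0 => y _; rewrite mule_ge0.
rewrite (@fubini_tonelli _ _ _ _ _ leb leb (fun z : R * R =>
    ((\1_A z.2)%:E * (\1_B ((c - a * d / b) * z.1 + d / b * z.2)%R)%:E)))//.
transitivity ((`|b|^-1)%:E *
    \int[leb]_v ((\1_A v)%:E * ((`|c - a * d / b|^-1)%:E * leb B))).
  congr (_ * _); apply: eq_integral => v _ /=.
  by rewrite ge0_integralZl//= ?int1//; exact: mind1.
rewrite ge0_integralZr//; last 2 first.
- exact/measurable_EFinP/measurable_indic.
- by rewrite mule_ge0// lee_fin invr_ge0.
rewrite integral_indic// setIT.
have -> : (`|a * d - b * c|^-1)%:E = (`|b|^-1)%:E * (`|c - a * d / b|^-1)%:E.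
  rewrite -EFinM -invfM -normrM -[in RHS]normrN; congr (`|_|^-1)%:E; by field.
rewrite -!muleA; congr (_ * _); rewrite !muleA; congr (_ * _); exact: muleC.
Qed.

End Parallelogram.

(** * Blockages that meet a link *)

Section Hitting.
Context (R : realType).

Definition hitting (r alpha : R) : set ((R * R) * (R * R)) :=
  [set z | blockage z.1 z.2.1 z.2.2 `&` link r alpha !=set0].

(* Cross products with the two directions eliminate one coefficient each from
   [c + s e_phi = u e_alpha]; multiplying by the sine avoids divisions. *)
Lemma hitting_transverse (r alpha : R) (c : R * R) (l phi : R) :
  sin (phi - alpha) != 0 ->
  hitting r alpha (c, (l, phi)) <->
  `|sin alpha * c.1 - cos alpha * c.2| <= `|sin (phi - alpha)| * (l / 2) /\
  0 <= (sin phi * c.1 - cos phi * c.2) * sin (phi - alpha) <=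
    r * sin (phi - alpha) ^+ 2.
Proof.
case: c => x y; have DE := sinB phi alpha.
set D := sin _ in DE * => D0.
have D2 : 0 < D ^+ 2 by rewrite exprn_even_gt0.
split => /=.
  move=> [p [[s sl ->] [u /andP[u0 ur] /= [e1 e2]]]].
  have xE : x = u * cos alpha - s * cos phi by rewrite -e1 addrK.
  have yE : y = u * sin alpha - s * sin phi by rewrite -e2 addrK.
  have -> : sin alpha * x - cos alpha * y = D * s by rewrite xE yE DE; ring.
  have -> : (sin phi * x - cos phi * y) * D = u * D ^+ 2 by rewrite xE yE DE; ring.
  rewrite normrM; split; first exact: ler_wpM2l.
  by rewrite mulr_ge0 ?(ltW D2)//= ler_wpM2r// ltW.
move=> [h1 /andP[h2 h3]].
pose u := (sin phi * x - cos phi * y) / D.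
pose s := (sin alpha * x - cos alpha * y) / D.
have uE : (sin phi * x - cos phi * y) * D = u * D ^+ 2 by rewrite /u; field.
exists (x + s * cos phi, y + s * sin phi); split => /=.
  exists s => //; rewrite /s normrM normfV ler_pdivrMr ?normr_gt0//.
  by rewrite [X in _ <= X]mulrC.
exists u.
  move: h2 h3; rewrite uE => h2 h3; apply/andP; split.
    by rewrite -(pmulr_lge0 _ D2).
  by rewrite -(ler_pM2r D2).
have ex : D * (x + s * cos phi) = D * (u * cos alpha).
  have -> : D * (x + s * cos phi) = D * x + (sin alpha * x - cos alpha * y) * cos phi.
    by rewrite /s; field.
  have -> : D * (u * cos alpha) = (sin phi * x - cos phi * y) * cos alpha.
    by rewrite /u; field.
  by rewrite DE; ring.
have ey : D * (y + s * sin phi) = D * (u * sin alpha).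
  have -> : D * (y + s * sin phi) = D * y + (sin alpha * x - cos alpha * y) * sin phi.
    by rewrite /s; field.
  have -> : D * (u * sin alpha) = (sin phi * x - cos phi * y) * sin alpha.
    by rewrite /u; field.
  by rewrite DE; ring.
by congr (_, _); apply: (mulfI D0).
Qed.

(** Parallel segments meet only on a common line, where the blockage covers the interval of
    half-length [l / 2] around the coordinate [t] of its center and the link covers [[0, r]]. The
    condition [0 <= l] is separate because a negative length gives an empty blockage. *)
Lemma hitting_parallel (r alpha : R) (c : R * R) (l phi : R) : 0 <= r ->
  sin (phi - alpha) = 0 ->
  hitting r alpha (c, (l, phi)) <->
  [/\ sin alpha * c.1 - cos alpha * c.2 = 0, 0 <= l,
      - (l / 2) <= cos alpha * c.1 + sin alpha * c.2 &
      cos alpha * c.1 + sin alpha * c.2 <= r + l / 2].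
Proof.
case: c => x y r0 D0 /=; set t := cos alpha * x + sin alpha * y.
pose k := cos (phi - alpha).
have cs := cos2Dsin2 alpha.
have k2 : k ^+ 2 = 1 by rewrite -(cos2Dsin2 (phi - alpha)) D0 expr0n addr0.
have phiE : phi = phi - alpha + alpha by rewrite subrK.
have cE : cos phi = k * cos alpha by rewrite phiE cosD D0 mul0r subr0.
have sE : sin phi = k * sin alpha by rewrite phiE sinD D0 mul0r add0r.
have nk : `|k| = 1.
  by apply/eqP; rewrite -(@eqrXn2 _ 2)// -normrX k2 normr1 expr1n.
split.
  move=> [p [[s /= sl ->] [u /andP[u0 ur] [e1 e2]]]].
  have xE : x = (u - s * k) * cos alpha by rewrite mulrBl -e1 cE mulrA addrK.
  have yE : y = (u - s * k) * sin alpha by rewrite mulrBl -e2 sE mulrA addrK.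
  have tE : t = u - s * k.
    have -> : t = (u - s * k) * (cos alpha ^+ 2 + sin alpha ^+ 2).
      by rewrite /t xE yE; ring.
    by rewrite cs mulr1.
  have : `|s * k| <= l / 2 by rewrite normrM nk mulr1.
  rewrite ler_norml => /andP[h1 h2].
  have : 0 <= l / 2 by apply: le_trans sl.
  split; [by rewrite xE yE; ring|lra|rewrite tE; lra|rewrite tE; lra].
move=> [e l0 t1 t2].
have xE : x = t * cos alpha.
  have -> : t * cos alpha = x * (cos alpha ^+ 2 + sin alpha ^+ 2) -
     sin alpha * (sin alpha * x - cos alpha * y) by rewrite /t; ring.
  by rewrite e cs; ring.
have yE : y = t * sin alpha.
  have -> : t * sin alpha = y * (cos alpha ^+ 2 + sin alpha ^+ 2) +
     cos alpha * (sin alpha * x - cos alpha * y) by rewrite /t; ring.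
  by rewrite e cs; ring.
(* The witness is the point of [[0, r]] nearest to [t]. *)
have [u u0r utl] : exists2 u, 0 <= u <= r & `|u - t| <= l / 2.
  have [tn|tp] := ltP t 0.
    by exists 0; [rewrite lexx|rewrite ler_norml; lra].
  have [tr|tr] := leP t r; first by exists t; rewrite ?tp ?tr// subrr normr0; lra.
  by exists r; [rewrite r0 lexx|rewrite ler_norml; lra].
exists (x + k * (u - t) * cos phi, y + k * (u - t) * sin phi); split => /=.
  by exists (k * (u - t)) => //; rewrite normrM nk mul1r.
exists u => //; congr (_, _).
  have -> : x + k * (u - t) * cos phi = x + k ^+ 2 * ((u - t) * cos alpha).
    by rewrite cE; ring.
  by rewrite k2 xE; ring.
have -> : y + k * (u - t) * sin phi = y + k ^+ 2 * ((u - t) * sin alpha).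
  by rewrite sE; ring.
by rewrite k2 yE; ring.
Qed.

(** The definition quantifies existentially over points, so it presents the set as a projection. The
    two characterisations eliminate the quantifiers and leave equations and inequalities between
    measurable functions. *)
Lemma measurable_hitting (r alpha : R) : 0 <= r -> measurable (hitting r alpha).
Proof.
move=> r0.
pose cx (z : (R * R) * (R * R)) : R := z.1.1.
pose cy (z : (R * R) * (R * R)) : R := z.1.2.
pose le (z : (R * R) * (R * R)) : R := z.2.1.
pose ph (z : (R * R) * (R * R)) : R := z.2.2.
have mcx : measurable_fun setT cx by exact: (measurableT_comp measurable_fst measurable_fst).
have mcy : measurable_fun setT cy by exact: (measurableT_comp measurable_snd measurable_fst).
have mle : measurable_fun setT le by exact: (measurableT_comp measurable_fst measurable_snd).
have mph : measurable_fun setT ph by exact: (measurableT_comp measurable_snd measurable_snd).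
have msin : measurable_fun setT (@sin R) by apply: continuous_measurable_fun; exact: continuous_sin.
have mcos : measurable_fun setT (@cos R) by apply: continuous_measurable_fun; exact: continuous_cos.
pose D z := sin (ph z - alpha).
have mD : measurable_fun setT D.
  by apply: (measurableT_comp msin); exact: measurable_funB.
have mlin a b : measurable_fun setT (fun z => a * cx z + b * cy z).
  by apply: measurable_funD; apply: measurable_funM.
have leP (f g : (R * R) * (R * R) -> R) : measurable_fun setT f -> measurable_fun setT g ->
    measurable [set z : (R * R) * (R * R) | f z <= g z].
  by move=> mf mg; rewrite -[X in measurable X]setTI; exact: measurable_fun_le.
have mD0 : measurable [set z | D z = 0].
  by rewrite -[X in measurable X]setTI; exact: (mD measurableT [set 0] (measurable_set1 _)).
pose A z := sin alpha * cx z - cos alpha * cy z.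
have mA : measurable_fun setT A.
  by rewrite /A; under eq_fun do rewrite -mulNr; exact: mlin.
have mA0 : measurable [set z | A z = 0].
  by rewrite -[X in measurable X]setTI; exact: (mA measurableT [set 0] (measurable_set1 _)).
pose F z := (sin (ph z) * cx z - cos (ph z) * cy z) * D z.
have mF : measurable_fun setT F.
  apply: measurable_funM => //; apply: measurable_funB; apply: measurable_funM => //.
    exact: (measurableT_comp msin mph).
  exact: (measurableT_comp mcos mph).
have mG : measurable_fun setT (fun z => r * D z ^+ 2).
  by apply: measurable_funM => //; exact: measurable_funX.
have mnA : measurable_fun setT (fun z => `|A z|) by exact: measurableT_comp.
have mnD : measurable_fun setT (fun z => `|D z| * (le z / 2)).
  by apply: measurable_funM; [exact: measurableT_comp|exact: measurable_funM].
have mt : measurable_fun setT (fun z => cos alpha * cx z + sin alpha * cy z) by exact: mlin.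
have ml2 : measurable_fun setT (fun z => le z / 2) by exact: measurable_funM.
rewrite (_ : hitting r alpha =
  ([set z | D z = 0] `&` ([set z | A z = 0] `&` [set z | 0 <= le z] `&`
    [set z | - (le z / 2) <= cos alpha * cx z + sin alpha * cy z] `&`
    [set z | cos alpha * cx z + sin alpha * cy z <= r + le z / 2])) `|`
  (~` [set z | D z = 0] `&` ([set z | `|A z| <= `|D z| * (le z / 2)] `&`
    [set z | 0 <= F z] `&` [set z | F z <= r * D z ^+ 2]))); last first.
  apply/seteqP; split => [[c [l f]]|[c [l f]]] /=; have [D0|D0] := eqVneq (sin (f - alpha)) 0.
  - by move=> /(hitting_parallel _ _ r0 D0)[? ? ? ?]; left.
  - by move=> /(hitting_transverse _ _ _ D0)[? /andP[? ?]]; right; split; [exact/eqP|].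
  - by move=> [[_ [[[? ?] ?] ?]]|[]//]; apply/(hitting_parallel _ _ r0 D0).
  - move=> [[/eqP]|[_ [[? h1] h2]]]; first by rewrite (negbTE D0).
    by apply/(hitting_transverse _ _ _ D0); split => //; rewrite h1 h2.
apply: measurableU; apply: measurableI => //.
- apply: measurableI; first apply: measurableI; first apply: measurableI => //.
  + exact: leP.
  + by apply: leP => //; exact: measurableT_comp.
  + by apply: leP => //; exact: measurable_funD.
- exact: measurableC.
- by apply: measurableI; first apply: measurableI; exact: leP.
Qed.

(** In the transverse case the two linear forms range over intervals of lengths [|D| * l] and
    [r * D ^+ 2], and their determinant is [D ^+ 2]. In the parallel case the centers lie on the
    line of the link. *)
Lemma area_hitting (r alpha l phi : R) : 0 <= r -> 0 <= l ->
  area (ysection (hitting r alpha) (l, phi)) =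
  (r * l * `|sin (phi - alpha)|)%:E.
Proof.
move=> r0 l0; have [D0|D0] := eqVneq (sin (phi - alpha)) 0.
  rewrite D0 normr0 mulr0; pose line : set (R * R) :=
    [set z | [set 0] (sin alpha * z.1 + - cos alpha * z.2) /\
             [set: R] (cos alpha * z.1 + sin alpha * z.2)].
  have det : sin alpha * sin alpha - - cos alpha * cos alpha = 1.
    by rewrite -(cos2Dsin2 alpha); ring.
  (* The line is a degenerate parallelogram, one side a point and the other the whole real line; the
     product of measures is 0 by the convention that 0 times infinity is 0. *)
  have line0 : area line = 0%E.
    rewrite area_parallelogram//; last by rewrite det oner_neq0.
    by rewrite [X in (_ * (X * _))%E]lebesgue_measure_set1 mul0e mule0.
  have mline : measurable line.
    have mf : measurable_fun setT (fun z : R * R => sin alpha * z.1 + - cos alpha * z.2).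
      by apply: measurable_funD; apply: measurable_funM.
    have := mf measurableT [set 0] (measurable_set1 _).
    by rewrite setTI (_ : _ @^-1` _ = line)//; apply/seteqP; split => z /= => [|[]].
  apply/eqP; rewrite eq_le [X in _ && X](_ : _ = true) ?andbT; last first.
    by rewrite /area measure_ge0.
  rewrite -[leRHS]line0.
  rewrite /area; apply: le_measure; rewrite ?inE//.
    by apply: measurable_ysection; exact: measurable_hitting.
  move=> c; rewrite /ysection/= inE => /(hitting_parallel _ _ r0 D0)[e _ _ _].
  by split => //=; rewrite mulNr.
have DE := sinB phi alpha; set D := sin _ in DE D0 *.
have nD : 0 < `|D| by rewrite normr_gt0.
pose I : set R := `[- (`|D| * (l / 2)), `|D| * (l / 2)]%classic.
pose J : set R := `[0, r * D ^+ 2]%classic.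
have det : sin alpha * - (D * cos phi) - - cos alpha * (D * sin phi) = D ^+ 2.
  by rewrite [D ^+ 2]expr2 {3}DE; ring.
rewrite (_ : ysection _ _ = [set z | I (sin alpha * z.1 + - cos alpha * z.2) /\
    J (D * sin phi * z.1 + - (D * cos phi) * z.2)]); last first.
  apply/seteqP; split => c; rewrite /ysection/= inE.
    move=> /(hitting_transverse _ _ _ D0); rewrite -/D => -[h1 h2].
    rewrite /I /J /= !in_itv/= mulNr -ler_norml; split => //.
    by move: h2; rewrite (_ : _ * D = D * sin phi * c.1 + - (D * cos phi) * c.2)//; ring.
  rewrite /I /J /= !in_itv/= mulNr -ler_norml => -[h1 h2].
  apply/(hitting_transverse _ _ _ D0); rewrite -/D; split => //.
  by rewrite (_ : _ * D = D * sin phi * c.1 + - (D * cos phi) * c.2)//; ring.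
rewrite area_parallelogram; [|exact: measurable_itv..|by rewrite det expf_neq0].
have itvE (u v : R) : u <= v -> lebesgue_measure `[u, v]%classic = (v - u)%:E.
  rewrite le_eqVlt => /predU1P[->|uv].
    by rewrite set_itv1 lebesgue_measure_set1 subrr.
  by rewrite lebesgue_measure_itv/= lte_fin uv EFinB.
rewrite det /I /J !itvE; last 2 first.
- by rewrite mulr_ge0// sqr_ge0.
- by rewrite lerNl ge0_cp// mulr_ge0// divr_ge0.
rewrite -!EFinM normrX; congr _%:E.
have -> : D ^+ 2 = `|D| ^+ 2 by rewrite -normrX ger0_norm// sqr_ge0.
by field; rewrite gt_eqF.
Qed.

End Hitting.

(** * Mean of the absolute sine *)

Section SineIntegral.
Context (R : realType).
Local Notation leb := (@lebesgue_measure R).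

(** Includes the degenerate interval [a = b], which occurs below when the splitting point is 0 or
    [pi]. *)
Lemma FTC2_itvcc (F f : R -> R) (a b : R) : a <= b ->
  (forall x : R, is_derive x (1 : R) F (f x)) -> continuous f ->
  (\int[leb]_(x in `[a, b]) (f x)%:E = (F b - F a)%:E)%E.
Proof.
move=> ab dF cf; have cF : continuous F.
  by move=> x; apply/differentiable_continuous/derivable1_diffP; exact: ex_derive.
move: ab; rewrite le_eqVlt => /predU1P[->|ab].
  by rewrite set_itv1 integral_set1 subrr.
rewrite (@continuous_FTC2 _ f F)//.
- exact: continuous_subspaceT.
- split; first by move=> x _; exact: ex_derive.
  + by apply: cvg_at_right_filter; exact: cF.
  + by apply: cvg_at_left_filter; exact: cF.
- by move=> x _; rewrite derive1E; exact: derive_val.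
Qed.

(* Up to the sign of the sine, [alpha] may be replaced by
   [t = acos (+- cos alpha)], which lies in [[0, pi]]. *)
Lemma integral_normr_sin (alpha : R) :
  (\int[leb]_(phi in `[0%R, pi]) `|sin (phi - alpha)|%:E = 2%:E)%E.
Proof.
have [t [t0 tpi st]] : exists t : R, [/\ 0 <= t, t <= pi &
    forall phi, `|sin (phi - alpha)| = `|sin (phi - t)|].
  pose c := if 0 <= sin alpha then cos alpha else - cos alpha.
  have cB : -1 <= c <= 1.
    by rewrite /c; case: ifPn => _; rewrite ?cos_geN1 ?cos_le1//
      lerN2 cos_le1 lerNl cos_geN1.
  exists (acos c); split; [exact: acos_ge0|exact: acos_lepi|move=> phi].
  have cE : cos (acos c) = c by rewrite acosK// in_itv/=.
  have sE : sin (acos c) = `|sin alpha|.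
    rewrite sin_acos// (_ : 1 - c ^+ 2 = sin alpha ^+ 2) ?sqrtr_sqr//.
    by rewrite sin2cos2 /c; case: ifPn; rewrite ?sqrrN.
  rewrite !sinB cE sE /c; case: ifPn => [s0|]; first by rewrite (ger0_norm s0).
  rewrite -ltNge => s0; rewrite (ltr0_norm s0) -[RHS]normrN; congr `|_|; ring.
have cs : continuous (fun phi : R => `|sin (phi - t)|).
  move=> x; apply: continuous_comp; last exact: norm_continuous.
  apply: continuous_comp; last exact: continuous_sin.
  by apply: continuousB => //; exact: cvg_cst.
under eq_integral do rewrite st.
have m1 : measurable_fun setT (fun phi : R => `|sin (phi - t)|%:E).
  by apply/measurable_EFinP; exact: continuous_measurable_fun.
rewrite (@itv_bndbnd_setU _ _ _ (BLeft t))//= ?bnd_simp//.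
rewrite ge0_integral_setU//=; last 2 first.
- exact: measurable_funTS.
- apply/disj_setPRL => x /=; rewrite !in_itv/= => /andP[tx _].
  by apply/negP; rewrite negb_and -leNgt tx orbT.
rewrite integral_itv_bndo_bndc; last exact: measurable_funTS.
(* As [0 <= t <= pi], the sine changes sign only at [t]; the two halves contribute [1 - cos t] and
   [1 + cos t]. *)
transitivity (\int[leb]_(x in `[0%R, t]) (sin (t - x))%:E +
    \int[leb]_(x in `[t, pi]) (sin (x - t))%:E)%E.
  congr (_ + _)%E; apply: eq_integral => x; rewrite inE/= in_itv/= => /andP[x0 xt].
    congr _%:E; rewrite -opprB sinN normrN ger0_norm// sin_ge0_pi// subr_ge0 xt/=.
    by rewrite (le_trans _ tpi)// lerBlDr lerDl.
  congr _%:E; rewrite ger0_norm// sin_ge0_pi// subr_ge0 x0/=.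
  by rewrite (le_trans _ xt)// lerBlDr lerDl.
have d1 (x : R) : is_derive x (1 : R) (fun x => cos (t - x)) (sin (t - x)).
  rewrite -[sin _]opprK -mulN1r mulrC.
  apply: (@is_derive1_comp R cos (fun x => t - x)).
  by apply: is_derive_eq; rewrite add0r mul1r.
have d2 (x : R) : is_derive x (1 : R) (fun x => - cos (x - t)) (sin (x - t)).
  rewrite -[sin _]opprK; apply: is_deriveN.
  rewrite -[- sin _]mulr1; apply: (@is_derive1_comp R cos (fun x => x - t)).
  by apply: is_derive_eq; rewrite ?oppr0 ?addr0 ?add0r ?mul1r.
have c1 : continuous (fun x : R => sin (t - x)).
  move=> x; apply: continuous_comp; last exact: continuous_sin.
  by apply: continuousB => //; exact: cvg_cst.
have c2 : continuous (fun x : R => sin (x - t)).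
  move=> x; apply: continuous_comp; last exact: continuous_sin.
  by apply: continuousB => //; exact: cvg_cst.
rewrite (FTC2_itvcc t0 d1 c1) (FTC2_itvcc tpi d2 c2).
rewrite -EFinD; congr _%:E; rewrite !subrr cos0 subr0 cosB cospi sinpi.
ring.
Qed.

End SineIntegral.

Section PlaneMeasure.
Context (R : realType).
Local Notation plane := (@lebesgue_measure R \x @lebesgue_measure R)%E.

Let sigma_finite_plane : sigma_finite setT plane.
Proof.
have /sigma_finiteP[F [FT ndF Ff]] := sigma_finiteT (@lebesgue_measure R).
exists (fun n => F n `*` F n).
  rewrite -setXTT FT; apply/seteqP; split => -[x y].
    move=> [/= [n _ Fx] [k _ Fy]]; exists (maxn n k) => //; split => /=.
      by move: x Fx; exact/subsetPset/ndF/leq_maxl.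
    by move: y Fy; exact/subsetPset/ndF/leq_maxr.
  by move=> [n _ []/= ? ?]; split; exists n.
move=> n; have [mF fF] := Ff n; split; first exact: measurableX.
by rewrite product_measure1E// lte_mul_pinfty// ge0_fin_numE.
Qed.

(* The library's product of sigma-finite measures is not found canonically as a
   sigma-finite measure: the instance for probabilities shadows it. *)
Definition plane_measure :=
  HB.pack_for {sigma_finite_measure set (measurableTypeR R * measurableTypeR R)%type -> \bar R}
    plane (Measure_isSigmaFinite.Build _ _ _ plane sigma_finite_plane).

End PlaneMeasure.

(** * Line-of-sight probabilities of one and two links *)

Section LineOfSight.
Context d (Omega : measurableType d) (R : realType) (P : probability Omega R)
  (mu : R) (X : nat -> {RV P >-> (R * R)%type}) (L Phi : nat -> {RV P >-> R}).
Hypotheses (mu0 : 0 < mu) (model : segment_boolean_model mu X L Phi).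
Local Notation plane := (@lebesgue_measure R \x @lebesgue_measure R)%E.
Local Notation mlaw := (mark_law L Phi).
Local Open Scope ereal_scope.

Let mPhi : measurable_fun setT (Phi 0%N : Omega -> measurableTypeR R).
Proof. exact: (measurable_funP (Phi 0%N)). Qed.

Let measurable_normr_sin alpha :
  measurable_fun setT (fun phi : R => `|sin (phi - alpha)|%:E).
Proof.
have cs : continuous (fun phi : R => `|sin (phi - alpha)|%R).
  move=> x; apply: continuous_comp; last exact: norm_continuous.
  apply: continuous_comp; last exact: continuous_sin.
  by apply: continuousB => //; exact: cvg_cst.
by apply/measurable_EFinP; exact: continuous_measurable_fun.
Qed.

(** The integral 2 over [[0, pi]], divided by [pi]. The direction [alpha] disappears here, which is
    the isotropy of the blockages. *)
Let integral_orientation alpha :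
  \int[distribution P (Phi 0%N)]_phi `|sin (phi - alpha)|%:E = (2 / pi)%:E.
Proof.
have m1 := measurable_normr_sin alpha.
rewrite ge0_integral_distribution//.
pose law : {measure set (measurableTypeR R) -> \bar R} :=
  measure_function_pushforward__canonical__measure_function_Measure P mPhi.
transitivity (\int[law]_phi `|sin (phi - alpha)|%:E).
  by rewrite [RHS](@ge0_integral_pushforward _ _ _ (measurableTypeR R) _ _ mPhi P setT).
rewrite (@eq_measure_integral _ _ _ _ (uniform_prob (@pi_gt0 R)) law); last first.
  by move=> A mA _; exact: (orientations_uniform model 0%N mA).
rewrite integral_uniform//.
by rewrite integral_normr_sin subr0 -EFinM mulrC.
Qed.

Let EL : R := fine 'E_P[L 0%N].

Let EL_E : \int[P]_w (L 0%N w)%:E = EL%:E.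
Proof.
rewrite -expectation_def /EL fineK// fin_numElt (lengths_mean_lty model) andbT.
by rewrite (lt_trans _ (lengths_mean_gt0 model)).
Qed.

(** Tonelli integrates over the centers first, at a fixed mark; the resulting area is a product of a
    function of the length and one of the orientation, so its mean under the product law factors. *)
Lemma measure_hitting (r alpha : R) : (0 <= r)%R ->
  \int[plane]_x mlaw (xsection (hitting r alpha) x) = (r * EL * (2 / pi))%:E.
Proof.
move=> r0; have mS := @measurable_hitting R r alpha r0.
transitivity (\int[mlaw]_m area (ysection (hitting r alpha) m)).
  pose pl := plane_measure R.
  pose S : set ((measurableTypeR R * measurableTypeR R) * (R * R)) := hitting r alpha.
  have mS' : measurable S := mS.
  have := @indic_fubini_tonelli _ _ _ _ R pl mlaw _ mS'.
  by rewrite indic_fubini_tonelli_FE// indic_fubini_tonelli_GE.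
have mG : measurable_fun setT (fun m => area (ysection (hitting r alpha) m)).
  pose pl := plane_measure R.
  pose S : set ((measurableTypeR R * measurableTypeR R) * (R * R)) := hitting r alpha.
  have mS' : measurable S := mS.
  exact: (measurable_fun_ysection pl mS').
have G0 m : 0 <= area (ysection (hitting r alpha) m) by rewrite /area measure_ge0.
rewrite /mark_law fubini_tonelli1// ge0_integral_distribution//; last 2 first.
  exact: (@measurable_fun_fubini_tonelli_F _ _ _ _ _
    (distribution P (Phi 0%N) : probability R R) _ mG G0).
  by move=> y; apply: integral_ge0 => x _; exact: G0.
transitivity (\int[P]_w ((r * (2 / pi))%:E * (L 0%N w)%:E)); last first.
  rewrite ge0_integralZl_EFin//.
  - by rewrite EL_E -EFinM; congr _%:E; ring.
  - by move=> w _; rewrite lee_fin; exact: lengths_ge0 model _ _.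
  - by apply/measurable_EFinP; exact: measurable_funP.
  - by rewrite mulr_ge0// divr_ge0// pi_ge0.
apply: eq_integral => w _; rewrite /= /fubini_F.
have L0 := lengths_ge0 model 0%N w.
under eq_integral do rewrite area_hitting// EFinM.
rewrite ge0_integralZl_EFin//.
- rewrite integral_orientation -!EFinM; congr _%:E; ring.
- by rewrite mulr_ge0.
Qed.

Let beta := blockage_rate mu L.

Lemma blockage_rate_gt0 : (0 < beta)%R.
Proof.
rewrite /beta /blockage_rate divr_gt0 ?pi_gt0// mulr_gt0 ?mulr_gt0//.
by rewrite fine_gt0// (lengths_mean_gt0 model) (lengths_mean_lty model).
Qed.

Let rateE r : (mu * (r * EL * (2 / pi)) = beta * r)%R.
Proof. by rewrite /beta /blockage_rate -/EL; ring. Qed.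

Let unblockedE r alpha : unblocked X L Phi (link r alpha) =
  [set w | forall n, ~ hitting r alpha (X n w, (L n w, Phi n w))].
Proof.
by apply/seteqP; split => w h n; [move/nonemptyPn : (h n)|apply/nonemptyPn; exact: h].
Qed.

Lemma pL_expR alpha r : (0 <= r)%R -> pL X L Phi alpha r = expR (- beta * r).
Proof.
move=> r0; rewrite /pL unblockedE.
rewrite (void_probability (ltW mu0) model (@measurable_hitting R r alpha r0)
  (measure_hitting alpha r0)).
by rewrite rateE mulNr.
Qed.

Lemma pLL_ge alpha r1 r2 theta : (0 <= r1)%R -> (0 <= r2)%R ->
  (independent_blocking beta r1 r2 theta <= pLL X L Phi alpha r1 r2 theta)%R.
Proof.
move=> r10 r20; rewrite /pLL !unblockedE.
set S1 := hitting r1 _; set S2 := hitting r2 _.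
have mS1 : measurable S1 by exact: measurable_hitting.
have mS2 : measurable S2 by exact: measurable_hitting.
have mS : measurable (S1 `|` S2) by exact: measurableU.
have -> : [set w | forall n, ~ S1 (X n w, (L n w, Phi n w))] `&`
    [set w | forall n, ~ S2 (X n w, (L n w, Phi n w))] =
    [set w | forall n, ~ (S1 `|` S2) (X n w, (L n w, Phi n w))].
  apply/seteqP; split => w /= => [[h1 h2] n []|h]; [exact: h1|exact: h2|].
  by split => n hn; apply: (h n); [left|right].
set H := \int[plane]_x mlaw (xsection (S1 `|` S2) x).
have mx (S : set ((R * R) * (R * R))) : measurable S ->
    measurable_fun setT (fun x => mlaw (xsection S x)).
  by move=> mS'; exact: (measurable_fun_xsection mlaw mS').
(* The sum counts twice the pairs that hit both links; this overlap is the whole gap between the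
   joint probability and independent blocking. The bound also gives the finiteness of [H] needed for
   [void_probability]. *)
have H_le : H <= ((r1 + r2) * EL * (2 / pi))%:E.
  apply: (@le_trans _ _ (\int[plane]_x (mlaw (xsection S1 x) + mlaw (xsection S2 x)))).
    apply: ge0_le_integral => //.
    - exact: mx.
    - by apply: emeasurable_funD; exact: mx.
    - move=> x _; rewrite !xsectionE preimage_setU -!xsectionE; apply: measureU2; exact: measurable_xsection.
  rewrite ge0_integralD//; [|exact: mx..].
  by rewrite !measure_hitting// -EFinD lee_fin -!mulrDl.
have H0 : 0 <= H by exact: integral_ge0.
have HE : H = (fine H)%:E.
  by rewrite fineK// ge0_fin_numE// (le_lt_trans H_le)// ltry.
rewrite (void_probability (ltW mu0) model mS HE) /= /independent_blocking ler_expR.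
have : (mu * fine H <= mu * ((r1 + r2) * EL * (2 / pi)))%R.
  by rewrite ler_pM2l// -lee_fin -HE.
by rewrite rateE; lra.
Qed.

End LineOfSight.

(** The integral of a nonnegative function is a supremum over the simple functions below it, hence
    monotone without measurability. The measurability of the joint probability in [t] and [theta]
    thus never has to be established. *)
Lemma ge0_le_integral_nonmeasurable d (T : measurableType d) (R : realType)
    (m : {measure set T -> \bar R}) (D : set T) (f g : T -> \bar R) :
  (forall x, D x -> 0 <= f x)%E -> (forall x, D x -> f x <= g x)%E ->
  (\int[m]_(x in D) f x <= \int[m]_(x in D) g x)%E.
Proof.
move=> f0 fg; have g0 x : D x -> (0 <= g x)%E.
  by move=> Dx; exact: le_trans (f0 x Dx) (fg x Dx).
rewrite (ge0_integralE _ f0) (ge0_integralE _ g0).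
apply: le_ereal_sup => _ [h hf <-]; exists h => // x.
apply: le_trans (hf x) _; rewrite !patchE; case: ifPn => // /set_mem.
exact: fg.
Qed.

(** * Comparison with independent blocking and closed forms *)

Section Functionals.
Context (R : realType) (lambda beta : R) (p : R -> R) (q : R -> R -> R -> R).
Hypotheses (lambda_gt0 : 0 < lambda) (beta_gt0 : 0 < beta)
  (pE : forall x, 0 <= x -> p x = expR (- beta * x))
  (q_ge : forall r1 r2 theta, 0 <= r1 -> 0 <= r2 ->
    independent_blocking beta r1 r2 theta <= q r1 r2 theta).
Local Notation leb := (@lebesgue_measure R).
Local Notation q_ind := (independent_blocking beta).

Let p_gt0 x : 0 <= x -> 0 < p x.
Proof. by move=> x0; rewrite pE// expR_gt0. Qed.

Let ratio_ge0 x t theta : 0 <= x -> 0 <= q_ind x t theta / p x.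
Proof. by move=> x0; rewrite divr_ge0 ?expR_ge0// ltW// p_gt0. Qed.

Let ratio_le x t theta : 0 <= x -> 0 <= t ->
  q_ind x t theta / p x <= q x t theta / p x.
Proof. by move=> x0 t0; rewrite ler_pM2r ?invr_gt0 ?p_gt0// q_ge. Qed.

Let ratioE x t theta : 0 <= x -> q_ind x t theta / p x = expR (- beta * t).
Proof.
move=> x0; rewrite pE// /independent_blocking expRD mulrAC mulfV ?mul1r ?mulNr//.
by rewrite gt_eqF ?expR_gt0.
Qed.

Lemma gL_le_independent x : 0 <= x -> (gL lambda p q x <= gL lambda p q_ind x)%E.
Proof.
move=> x0; rewrite /gL; apply: lee_wpmul2l; first by rewrite lee_fin ltW// p_gt0.
rewrite lee_expeR leeN2; apply: lee_wpmul2l; first by rewrite lee_fin ltW.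
have tx t : `[0, x]%classic t -> 0 <= t by rewrite /= in_itv/= => /andP[].
apply: ge0_le_integral_nonmeasurable => theta _.
  by apply: integral_ge0 => t /tx t0; rewrite lee_fin mulr_ge0// ratio_ge0.
apply: ge0_le_integral_nonmeasurable => t /tx t0; rewrite lee_fin.
  by rewrite mulr_ge0// ratio_ge0.
by rewrite ler_wpM2r// ratio_le.
Qed.

Lemma AL_le_independent : (AL lambda p q <= AL lambda p q_ind)%E.
Proof.
have c0 : 0 <= 2 * pi * lambda by rewrite !mulr_ge0 ?pi_ge0// ltW.
rewrite /AL; apply: lee_wpmul2l; first by rewrite lee_fin.
apply: ge0_le_integral_nonmeasurable => x; rewrite /= in_itv/= andbT => x0.
  by rewrite mule_ge0// mule_ge0 ?expeR_ge0// lee_fin ltW// p_gt0.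
by apply: lee_wpmul2r; [rewrite lee_fin|exact: gL_le_independent].
Qed.

Let integral_2pi (k : R) :
  (\int[leb]_(theta in `[0%R, (2 * pi)%R]) k%:E = (2 * pi * k)%:E)%E.
Proof.
have pi2 : 0 < 2 * pi :> R by rewrite mulr_gt0// pi_gt0.
rewrite integral_cst//= lebesgue_measure_itv/= lte_fin pi2.
by rewrite sube0 -EFinM mulrC.
Qed.

Lemma kappaLL_le_independent (ell : R -> R) (r tau : R) : 0 <= r -> 0 < tau ->
  (forall t, 0 <= t -> 0 < ell t) ->
  (kappaLL lambda ell p q r tau <= kappaLL lambda ell p q_ind r tau)%E.
Proof.
move=> r0 tau0 ell0; rewrite /kappaLL lee_expeR leeN2.
apply: ge0_le_integral_nonmeasurable => t; rewrite /= in_itv/= andbT => rt;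
  have t0 := le_trans r0 rt.
all: have c0 : 0 <= lambda / (1 + tau^-1 * (ell r / ell t)).
all: try by rewrite divr_ge0 ?(ltW lambda_gt0)// addr_ge0// mulr_ge0 ?invr_ge0 ?divr_ge0// ltW// ell0.
  rewrite mule_ge0// mule_ge0//; apply: integral_ge0 => theta _.
  by rewrite lee_fin ratio_ge0.
apply: lee_wpmul2r; first by rewrite lee_fin.
apply: lee_wpmul2l; first by rewrite lee_fin.
apply: ge0_le_integral_nonmeasurable => theta _; rewrite lee_fin.
  exact: ratio_ge0.
exact: ratio_le.
Qed.

Lemma kappaLL_independent (ell : R -> R) (r tau : R) : 0 <= r ->
  kappaLL lambda ell p q_ind r tau = kappaLL_bar lambda beta ell r tau.
Proof.
move=> r0; rewrite /kappaLL /kappaLL_bar; congr (expeR (- _))%E.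
apply: eq_integral => t _.
under eq_integral do rewrite ratioE//.
by rewrite integral_2pi -!EFinM; congr _%:E; ring.
Qed.

Let expRN_linear (x : R) : is_derive x (1 : R) (fun x => expR (- beta * x))
  (- beta * expR (- beta * x)).
Proof.
rewrite mulrC; apply: (@is_derive1_comp R expR (fun x => - beta * x)).
by apply: is_derive_eq; rewrite /GRing.scale/= mulr1.
Qed.

(** [(1 - decay x) / beta ^+ 2] is the primitive of [expR (- beta * x) * x] that vanishes at 0; this
    is the origin of the exponent in [gL_bar]. *)
Let decay (x : R) := (1 + beta * x) * expR (- beta * x).

Let is_derive_decay (x : R) :
  is_derive x (1 : R) decay (- (beta ^+ 2 * (expR (- beta * x) * x))).
Proof.
pose proof (expRN_linear x) as h.
have h2 : is_derive x (1 : R) (fun x => 1 + beta * x) beta.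
  by apply: is_derive_eq; rewrite /GRing.scale/=; ring.
apply: (@is_derive_eq _ _ _ _ _ _ _ _ (is_deriveM h2 h)).
by rewrite /GRing.scale/=; ring.
Qed.

Let continuous_expRN_linear : continuous (fun x => expR (- beta * x)).
Proof.
move=> x; apply: continuous_comp; last exact: continuous_expR.
by apply: cvgM; [exact: cvg_cst|exact: cvg_id].
Qed.

Let continuous_weight : continuous (fun x => expR (- beta * x) * x).
Proof. by move=> x; apply: cvgM; [exact: continuous_expRN_linear|exact: cvg_id]. Qed.

Lemma gL_independent x : 0 <= x ->
  gL lambda p q_ind x = (gL_bar lambda beta x)%:E.
Proof.
move=> x0; have b2 : beta ^+ 2 != 0 by rewrite expf_neq0// gt_eqF.
have dF (t : R) : is_derive t (1 : R) (fun t => - (beta ^+ 2)^-1 * decay t)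
    (expR (- beta * t) * t).
  pose proof (is_derive_decay t) as h.
  apply: (@is_derive_eq _ _ _ _ _ _ _ _ (is_deriveM (is_derive_cst (- (beta ^+ 2)^-1) t 1) h)).
  by rewrite /GRing.scale/=; field; rewrite gt_eqF.
have inner : (\int[leb]_(t in `[0%R, x]) (expR (- beta * t) * t)%:E =
    ((1 - decay x) / beta ^+ 2)%:E)%E.
  rewrite (FTC2_itvcc x0 dF continuous_weight); congr _%:E.
  by rewrite /decay !mulr0 expR0 addr0 mulr1; field; rewrite gt_eqF.
rewrite /gL; under eq_integral.
  move=> theta _; under eq_integral do rewrite ratioE//.
  rewrite inner; over.
rewrite integral_2pi pE// -EFinM -expRD; congr (expR _)%:E.
by rewrite /decay; field; rewrite gt_eqF.
Qed.

(** With [y = beta * x], squaring [1 + y / 2 <= expR (y / 2)] gives [expR y >= (1 + y) ^+ 2 / 4].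
    Hence [decay x <= 4 / (1 + y)], which is at most [e] once [y >= 4 / e]. *)
Let decay_cvg : decay x @[x --> +oo] --> 0.
Proof.
apply/cvgrPdist_le => e e0; near=> x.
have x0 : 0 < x by near: x; exact: nbhs_pinfty_gt.
have y0 : 0 < beta * x by rewrite mulr_gt0.
have ye : 4 / e <= beta * x.
  by rewrite [beta * x]mulrC -ler_pdivrMr//; near: x; exact: nbhs_pinfty_ge.
have d0 : 0 <= decay x by rewrite mulr_ge0 ?expR_ge0// addr_ge0// ltW.
rewrite sub0r normrN ger0_norm// /decay mulNr expRN.
move: (beta * x) y0 ye => y y0 ye.
have h1 : 1 + y / 2 <= expR (y / 2) by exact: expR_ge1Dx.
have h2 : (1 + y) ^+ 2 / 4 <= expR y.
  have -> : expR y = expR (y / 2) ^+ 2 by rewrite expr2 -expRD -splitr.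
  have : (1 + y / 2) ^+ 2 <= expR (y / 2) ^+ 2 by rewrite ler_sqr ?nnegrE ?expR_ge0//; lra.
  by apply: le_trans; nra.
rewrite ler_pdivrMr ?expR_gt0//.
have h3 : 4 <= e * y by move: ye; rewrite ler_pdivrMr// mulrC.
apply: (@le_trans _ _ (e * ((1 + y) ^+ 2 / 4))); last by rewrite ler_wpM2l// ltW.
have h4 : 4 <= e * (1 + y) by rewrite mulrDr mulr1; lra.
have -> : e * ((1 + y) ^+ 2 / 4) = (e * (1 + y)) * ((1 + y) / 4) by field.
have : 4 * ((1 + y) / 4) <= (e * (1 + y)) * ((1 + y) / 4).
  by rewrite ler_wpM2r//; lra.
lra.
Unshelve. all: by end_near. Qed.

Lemma AL_independent : AL lambda p q_ind = (AL_bar lambda beta)%:E.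
Proof.
have b2 : beta ^+ 2 != 0 by rewrite expf_neq0// gt_eqF.
have k0 : 0 < 2 * pi * lambda by rewrite mulr_gt0// mulr_gt0// pi_gt0.
set k := 2 * pi * lambda in k0; pose c := k / beta ^+ 2.
(* The integrand is an exact derivative: its factor [expR (- beta * x) * x] is, up to [beta ^+ 2],
   the derivative of [1 - decay x]. Since [decay] falls from 1 to 0, [F] rises from [- k^-1] to
   [- k^-1 * expR (- c)], and multiplying by [k] gives [1 - expR (- c)]. *)
pose F x := - k^-1 * expR (- c * (1 - decay x)).
have dF (x : R) : is_derive x (1 : R) F (gL_bar lambda beta x * x).
  pose proof (is_derive_decay x) as h.
  have h1 : is_derive x (1 : R) (fun x => - c * (1 - decay x))
      (- c * (beta ^+ 2 * (expR (- beta * x) * x))).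
    apply: is_derive_eq; rewrite /GRing.scale/=; ring.
  have h2 := @is_derive1_comp R expR (fun x => - c * (1 - decay x)) x _ _
    (is_derive_expR _) h1.
  apply: (@is_derive_eq _ _ _ _ _ _ _ _ (is_deriveM (is_derive_cst (- k^-1) x 1) h2)).
  rewrite /GRing.scale/= /gL_bar -/k -/c -/(decay x) mulr0 addr0.
  have -> : - beta * x - c * (1 - decay x) = - beta * x + - c * (1 - decay x) by ring.
  rewrite expRD /c; field.
  by rewrite !gt_eqF.
have dF1 (x : R) : derivable F x 1 by have [] := dF x.
have cF : continuous F.
  by move=> x; apply/differentiable_continuous/derivable1_diffP; exact: dF1.
have cdecay : continuous decay.
  move=> x; apply/differentiable_continuous/derivable1_diffP.
  by have [] := is_derive_decay x.
transitivity (k%:E * \int[leb]_(x in `[0%R, +oo[) (gL_bar lambda beta x * x)%:E)%E.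
  congr (_ * _)%E; apply: eq_integral => x.
  by rewrite inE/= in_itv/= andbT => x0; rewrite gL_independent// EFinM.
rewrite (@ge0_continuous_FTC2y _ _ F 0 (- k^-1 * expR (- c))).
- rewrite -/k -EFinB -EFinM; congr _%:E.
  rewrite /F /decay !mulr0 addr0 mul1r expR0 subrr mulr0 expR0 mulr1 /AL_bar -/k -/c mulNr.
  by field; rewrite gt_eqF.
- by move=> x x0; rewrite mulr_ge0// expR_ge0.
- apply: continuous_subspaceT => x; apply: cvgM; last exact: cvg_id.
  rewrite /gL_bar -/k -/c; apply: continuous_comp; last exact: continuous_expR.
  apply: cvgB; first by apply: cvgM; [exact: cvg_cst|exact: cvg_id].
  by apply: cvgM; [exact: cvg_cst|apply: cvgB; [exact: cvg_cst|exact: cdecay]].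
- apply: cvgM; first exact: cvg_cst.
  apply: (@continuous_cvg _ _ _ _ _ (fun x => - c * (1 - decay x)) expR).
    exact: continuous_expR.
  have : - c * (1 - decay x) @[x --> +oo] --> - c * (1 - 0).
    apply: cvgM; first exact: cvg_cst.
    by apply: cvgB; [exact: cvg_cst|exact: decay_cvg].
  by rewrite subr0 mulr1.
- by move=> x _; exact: dF1.
- by apply: cvg_at_right_filter; exact: cF.
- by move=> x _; rewrite derive1E; have [] := dF x.
Qed.

End Functionals.

Theorem lemma10 (R : realType) (d : measure_display) (Omega : measurableType d)
    (P : probability Omega R)
    (lambda : R) (lambda_gt0 : 0 < lambda)
    (mu : R) (mu_gt0 : 0 < mu)
    (X : nat -> {RV P >-> (R * R)%type}) (L Phi : nat -> {RV P >-> R})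
    (blockages : segment_boolean_model mu X L Phi)
    (ell : R -> R)
    (ell_gt0 : forall t, 0 <= t -> 0 < ell t)
    (ell_bounded : exists M, forall t, 0 <= t -> ell t <= M)
    (ell_nonincreasing : forall s t, 0 <= s -> s <= t -> ell t <= ell s)
    (alpha r tau : R) (r_gt0 : 0 < r) (tau_gt0 : 0 < tau) :
  let beta := blockage_rate mu L in
  let p := pL X L Phi alpha in
  let q := pLL X L Phi alpha in
  let q_ind := independent_blocking beta in
  [/\ (gL lambda p q r <= (gL_bar lambda beta r)%:E)%E,
      (AL lambda p q <= (AL_bar lambda beta)%:E)%E &
      (kappaLL lambda ell p q r tau <= kappaLL_bar lambda beta ell r tau)%E]
  /\
  [/\ gL lambda p q_ind r = (gL_bar lambda beta r)%:E,
      AL lambda p q_ind = (AL_bar lambda beta)%:E &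
      kappaLL lambda ell p q_ind r tau = kappaLL_bar lambda beta ell r tau].
Proof.
move=> beta p q q_ind.
have beta_gt0 : 0 < beta := blockage_rate_gt0 mu_gt0 blockages.
have pE x : 0 <= x -> p x = expR (- beta * x) := @pL_expR _ _ _ _ _ _ _ _ mu_gt0 blockages alpha x.
have q_ge r1 r2 theta : 0 <= r1 -> 0 <= r2 ->
    independent_blocking beta r1 r2 theta <= q r1 r2 theta.
  exact: (pLL_ge mu_gt0 blockages).
have r0 := ltW r_gt0.
have gE := gL_independent lambda beta_gt0 pE r0.
have AE := AL_independent lambda_gt0 beta_gt0 pE.
have kE := kappaLL_independent lambda pE ell tau r0.
split; last by split.
(* With the closed forms replaced by the values under independent blocking, each bound compares one
   functional at [q] and at [q_ind]. *)
rewrite -gE -AE -kE; split.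
- exact: gL_le_independent.
- exact: AL_le_independent.
- exact: kappaLL_le_independent.
Qed.
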